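(* Let $k$ be a real number with $0<k^2<1$. If the series below converges, then $$\sum_{n=0}^{\infty} \frac{(-1)^{\lfloor n/2\rfloor}}{e^{(2n+1)\frac{K'}{K}\pi}+1} = \frac12-\frac{\sqrt{k'}\left(\sqrt{1-k}+\sqrt{1+k}\right)K}{2\pi}.$$
   Context: For the elliptic modulus $k$ (with $0<k^2<1$), write $k'=\sqrt{1-k^2}$. The complete elliptic integral of the first kind is $K=K(k)=\int_0^{\pi/2}\frac{d\theta}{\sqrt{1-k^2\sin^2\theta}}$, and $K'=K(k')$. *)

(* Defs.v *)
(* Stdlib reals with Coquelicot. *)
From Stdlib Require Import Reals.
From Coquelicot Require Import Coquelicot.
Open Scope R_scope.

Definition compl_modulus (k : R) : R := sqrt (1 - k ^ 2).

(* For k ^ 2 < 1 the integrand is continuous on [0, PI / 2], so this is a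
   proper Riemann integral; elsewhere the value of RInt is not used. *)
Definition ellK (k : R) : R :=
  RInt (fun theta => / sqrt (1 - k ^ 2 * sin theta ^ 2)) 0 (PI / 2).

Definition ellK' (k : R) : R := ellK (compl_modulus k).

(* (n / 2)%nat is Euclidean division, i.e. the floor of n / 2. *)
Definition summand (k : R) (n : nat) : R :=
  (-1) ^ (n / 2)%nat
  / (exp ((2 * INR n + 1) * (ellK' k / ellK k) * PI) + 1).

(* Main.v *)
Require Import Defs.
From Stdlib Require Import Reals ZArith Lia Lra.
From Coquelicot Require Import Coquelicot.
Open Scope R_scope.

(** Write q = exp (- PI K'/K), and let phi(q) be the sum over Z of q^(n^2).

    The theorem combines two facts about q.  The first is arithmetic:
    the series equals 1/2 - phi(-q) phi(q^2) / 2 ([odd_lambert_series]).  The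
    second is the theta parametrization K = (PI/2) phi(q)^2 and
    k' = (phi(-q)/phi(q))^2 ([ellK_nome], [theta_modulus_nome]).  Together with
    (sqrt(1-k) + sqrt(1+k))^2 = 2 (1 + k') = 4 (phi(q^2)/phi(q))^2 they give the
    right-hand side.

    Both facts rest on the same principle ([squaring_invariant]): a quantity
    that takes the same value at q and q^2 equals its limit at 0.  The relations
    between theta values that feed it, namely
      phi(q)^2 + phi(-q)^2 = 2 phi(q^2)^2,   phi(q) phi(-q) = phi(-q^2)^2,
      psi(q)^2 = phi(q) psi(q^2),            phi(q) + phi(-q) = 2 phi(q^4),
    come from rearranging absolutely convergent double sums over Z^2 along the
    diagonals m + n = d ([zsum_convolution]).

    Series.  Expanding 1/(1+y) and exchanging the summations turns the series
    into (1 - g(-q))/2, where g(q) = 2 sum_j q^j/(1+q^(4j)), j in Z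
    ([lambert]).  A case of Kronecker's formula, psi(-q) g(q) = c psi(q) with c
    even in q, gives g(q)/phi(q) = g(-q)/phi(-q).  Since g(q) + g(-q) = 2 g(q^2),
    the quotient g(q)/(phi(q) phi(q^2)) is invariant under squaring, so it is 1.

    Elliptic integrals.  Let m(q) = (phi(-q)/phi(q))^2.  The first two theta
    relations say that m(q^2) = 2 sqrt(m)/(1+m), which is Landen's
    transformation of the modulus ([landen]).  Hence K(sqrt(1-m^2))/phi^2 is
    invariant under squaring, with limit PI/2; and K(m)/(phi^2 ln q) is
    invariant too, with limit -1/2, because K(k') = -ln k + O(1) while
    1 - m^2 is of the order of q.  So q is the nome attached to the
    complementary modulus m(q).  Conversely the nome determines the modulus, as
    K is strictly increasing ([ellK_ratio_inj]); this identifies m(q) with k'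
    when q is the nome of k. *)

(** * Interchange of limits and sums *)

(* An equation between terms of real sequences may be typed in an algebraic
   structure over R, where ring does not apply. *)
Ltac ring_R := match goal with |- @eq _ ?x ?y => change (@eq R x y) end; ring.

Lemma ex_series_le_R (a b : nat -> R) :
  (forall n, Rabs (a n) <= b n) -> ex_series b -> ex_series a.
Proof. intros H Hb. exact (ex_series_le a b H Hb). Qed.

Lemma ex_series_plus_R (a b : nat -> R) :
  ex_series a -> ex_series b -> ex_series (fun n => a n + b n).
Proof. intros [la Ha] [lb Hb]. exists (la + lb). exact (is_series_plus a b la lb Ha Hb). Qed.

Lemma ex_series_scal_R (c : R) (a : nat -> R) :
  ex_series a -> ex_series (fun n => c * a n).
Proof. intros [l Ha]. exists (c * l). exact (is_series_scal c a l Ha). Qed.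

Lemma Series_ge_0 (a : nat -> R) :
  (forall n, 0 <= a n) -> ex_series a -> 0 <= Series a.
Proof.
  intros H Ha.
  replace 0 with (Series (fun n : nat => 0 * 0)) by (rewrite Series_scal_l; ring).
  apply Series_le; [intros n; rewrite Rmult_0_l; split; [lra | apply H] | exact Ha].
Qed.

Lemma tail_small (M : nat -> R) (eps : R) :
  ex_series M -> 0 < eps ->
  exists K, Rabs (Series (fun n => M (S K + n)%nat)) < eps.
Proof.
  intros HM Heps.
  assert (Hl : is_lim_seq (sum_n M) (Series M)) by exact (Series_correct M HM).
  destruct (proj2 (is_lim_seq_spec _ _) Hl (mkposreal eps Heps)) as [K HK].
  exists K. specialize (HK K (Nat.le_refl K)). simpl in HK.
  rewrite sum_n_Reals in HK.
  rewrite (Series_incr_n M (S K)) in HK; [| lia | exact HM].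
  simpl Init.Nat.pred in HK.
  replace (sum_f_R0 M K - (sum_f_R0 M K + Series (fun k : nat => M (S K + k)%nat)))
    with (- Series (fun k : nat => M (S K + k)%nat)) in HK by ring.
  rewrite Rabs_Ropp in HK. exact HK.
Qed.

(** Cut the dominating series where its tail is below eps/2; what remains is a
    finite sum of null sequences. *)
Lemma tannery_zero (d : nat -> nat -> R) (M : nat -> R) :
  ex_series M -> (forall N n, 0 <= d N n <= M n) ->
  (forall n, is_lim_seq (fun N => d N n) 0) ->
  is_lim_seq (fun N => Series (d N)) 0.
Proof.
  intros HM Hd Hlim.
  assert (Hex : forall N, ex_series (d N)).
  { intros N. apply (ex_series_le_R _ M); [| exact HM].
    intros n. rewrite Rabs_pos_eq; apply Hd. }
  assert (Hfin : forall K, is_lim_seq (fun N => sum_f_R0 (d N) K) 0).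
  { induction K as [| K IH]; simpl; [apply Hlim |].
    replace (Finite 0) with (Finite (0 + 0)) by (f_equal; ring).
    apply is_lim_seq_plus'; [exact IH | apply Hlim]. }
  apply is_lim_seq_spec. intros [eps Heps]. simpl.
  destruct (tail_small M (eps / 2) HM ltac:(lra)) as [K HK].
  destruct (proj2 (is_lim_seq_spec _ _) (Hfin K) (mkposreal (eps / 2) ltac:(lra)))
    as [N0 HN0]; simpl in HN0.
  exists N0. intros N HN. specialize (HN0 N HN).
  rewrite Rminus_0_r in HN0 |- *.
  rewrite (Series_incr_n (d N) (S K)); [| lia | apply Hex]. simpl Init.Nat.pred.
  assert (HexM : ex_series (fun n => M (S K + n)%nat)) by (apply ex_series_incr_n; exact HM).
  assert (Htail : 0 <= Series (fun k => d N (S K + k)%nat) <= Series (fun n => M (S K + n)%nat)).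
  { split.
    - apply Series_ge_0; [intros n; apply Hd |].
      apply (ex_series_incr_n (d N)), Hex.
    - apply Series_le; [intros n; apply Hd | exact HexM]. }
  pose proof (Rle_abs (Series (fun n => M (S K + n)%nat))).
  apply Rle_lt_trans with (1 := Rabs_triang _ _).
  rewrite (Rabs_pos_eq _ (proj1 Htail)). lra.
Qed.

(** Dominated convergence for series: the previous lemma applies to
    |u - v|, which is dominated by 2 M. *)
Lemma tannery (u : nat -> nat -> R) (v M : nat -> R) :
  ex_series M -> (forall N n, Rabs (u N n) <= M n) ->
  (forall n, is_lim_seq (fun N => u N n) (v n)) ->
  is_lim_seq (fun N => Series (u N)) (Series v).
Proof.
  intros HM Hu Hlim.
  assert (Hv : forall n, Rabs (v n) <= M n).
  { intros n.
    exact (is_lim_seq_le (fun N => Rabs (u N n)) (fun _ => M n) (Rabs (v n)) (M n)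
      (fun N => Hu N n) (is_lim_seq_abs _ _ (Hlim n)) (is_lim_seq_const (M n))). }
  assert (Hexu : forall N, ex_series (u N)) by (intros N; apply (ex_series_le_R _ M (Hu N) HM)).
  assert (Hexv : ex_series v) by apply (ex_series_le_R _ M Hv HM).
  assert (Hz : is_lim_seq (fun N => Series (fun n => Rabs (u N n - v n))) 0).
  { apply (tannery_zero _ (fun n => 2 * M n)).
    - apply ex_series_scal_R, HM.
    - intros N n. split; [apply Rabs_pos |].
      apply Rle_trans with (1 := Rabs_triang _ _). rewrite Rabs_Ropp.
      specialize (Hu N n). specialize (Hv n). lra.
    - intros n. rewrite <- Rabs_R0. apply is_lim_seq_abs with (l := Finite 0).
      replace (Finite 0) with (Finite (v n - v n)) by (f_equal; ring).
      apply is_lim_seq_minus'; [apply Hlim | apply is_lim_seq_const]. }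
  apply is_lim_seq_ext with (fun N => Series v + (Series (u N) - Series v)); [intros; ring |].
  replace (Finite (Series v)) with (Finite (Series v + 0)) by (f_equal; ring).
  apply is_lim_seq_plus'; [apply is_lim_seq_const |].
  apply is_lim_seq_abs_0.
  apply (is_lim_seq_le_le (fun _ => 0) _ _ 0) with (3 := Hz); [| apply is_lim_seq_const].
  intros N. split; [apply Rabs_pos |].
  rewrite <- Series_minus by auto. apply Series_Rabs.
  apply (ex_series_le_R _ (fun n => 2 * M n)); [| apply ex_series_scal_R, HM].
  intros n. rewrite Rabs_Rabsolu. apply Rle_trans with (1 := Rabs_triang _ _).
  rewrite Rabs_Ropp. specialize (Hu N n). specialize (Hv n). lra.
Qed.

Lemma sum_n_Series_swap (a : nat -> nat -> R) (N : nat) :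
  (forall m, ex_series (fun n => a n m)) ->
  ex_series (fun n => sum_n (a n) N) /\
  Series (fun n => sum_n (a n) N) = sum_n (fun m => Series (fun n => a n m)) N.
Proof.
  intros Hex. induction N as [| N [IH1 IH2]].
  - split.
    + apply ex_series_ext with (2 := Hex O). intros n. now rewrite sum_O.
    + rewrite sum_O. apply Series_ext. intros n. now rewrite sum_O.
  - split.
    + apply ex_series_ext with (fun n => sum_n (a n) N + a n (S N)).
      { intros n. now rewrite sum_Sn. }
      now apply ex_series_plus_R.
    + rewrite sum_Sn, <- IH2. unfold plus; simpl.
      rewrite <- Series_plus by auto. apply Series_ext. intros n. now rewrite sum_Sn.
Qed.

Lemma sum_n_abs_le (a : nat -> R) (N : nat) :
  ex_series (fun n => Rabs (a n)) ->
  Rabs (sum_n a N) <= Series (fun n => Rabs (a n)).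
Proof.
  intros Hex. apply Rle_trans with (sum_n (fun n => Rabs (a n)) N).
  - rewrite !sum_n_Reals. apply Rsum_abs.
  - apply (is_lim_seq_incr_compare (sum_n (fun n => Rabs (a n)))).
    + exact (Series_correct _ Hex).
    + intros n. rewrite sum_Sn. unfold plus; simpl.
      pose proof (Rabs_pos (a (S n))). lra.
Qed.

Lemma term_le_Series (a : nat -> R) (N : nat) :
  (forall n, 0 <= a n) -> ex_series a -> a N <= Series a.
Proof.
  intros Hp Hex. apply Rle_trans with (sum_n a N).
  - destruct N; [rewrite sum_O; lra |].
    rewrite sum_Sn. unfold plus; simpl.
    assert (0 <= sum_n a N) by (rewrite sum_n_Reals; apply cond_pos_sum; exact Hp). lra.
  - apply (is_lim_seq_incr_compare (sum_n a)).
    + exact (Series_correct _ Hex).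
    + intros n. rewrite sum_Sn. unfold plus; simpl. specialize (Hp (S n)). lra.
Qed.

(** A partial sum over m of the column sums is the sum over n of partial row
    sums, so the interchange is dominated convergence, with the absolute row
    sums as dominating sequence. *)
Lemma Series_fubini (a : nat -> nat -> R) :
  (forall n, ex_series (fun m => Rabs (a n m))) ->
  ex_series (fun n => Series (fun m => Rabs (a n m))) ->
  is_series (fun m => Series (fun n => a n m)) (Series (fun n => Series (a n))).
Proof.
  intros Hrow Hdom.
  assert (Hcol : forall m, ex_series (fun n => a n m)).
  { intros m. apply (ex_series_le_R _ _) with (2 := Hdom). intros n.
    apply (term_le_Series (fun m => Rabs (a n m))); [intros; apply Rabs_pos | apply Hrow]. }
  change (is_lim_seq (sum_n (fun m => Series (fun n => a n m)))
    (Series (fun n => Series (a n)))).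
  apply is_lim_seq_ext with (fun N => Series (fun n => sum_n (a n) N)).
  { intros N. now apply sum_n_Series_swap. }
  apply tannery with (1 := Hdom).
  - intros N n. now apply sum_n_abs_le.
  - intros n. exact (Series_correct _ (ex_series_Rabs _ (Hrow n))).
Qed.

(** * Sums over the integers *)

(** Pairing n with -n-1 (not with -n) treats the two halves of Z alike: the
    flip n -> -n-1 preserves every pair, and it exchanges even and odd indices,
    which makes [zsum_parity] an identity between pairs. *)
Definition bilateral (f : Z -> R) (n : nat) : R :=
  f (Z.of_nat n) + f (- Z.of_nat n - 1)%Z.

Definition zsum (f : Z -> R) : R := Series (bilateral f).

Definition zsummable (f : Z -> R) : Prop :=
  ex_series (bilateral (fun n => Rabs (f n))).

Lemma zsummable_halves (f : Z -> R) :
  zsummable f <->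
  ex_series (fun n => Rabs (f (Z.of_nat n))) /\
  ex_series (fun n => Rabs (f (- Z.of_nat n - 1)%Z)).
Proof.
  split.
  - intros H; split; (apply (ex_series_le_R _ _) with (2 := H); intros n;
      unfold bilateral; rewrite Rabs_Rabsolu;
      pose proof (Rabs_pos (f (Z.of_nat n)));
      pose proof (Rabs_pos (f (- Z.of_nat n - 1)%Z)); lra).
  - intros [H1 H2]. exact (ex_series_plus_R _ _ H1 H2).
Qed.

Lemma zsummable_ex_abs (f : Z -> R) :
  zsummable f -> ex_series (fun n => Rabs (bilateral f n)).
Proof.
  intros H. apply (ex_series_le_R _ _) with (2 := H). intros n.
  rewrite Rabs_Rabsolu. apply Rabs_triang.
Qed.

Lemma zsummable_ex (f : Z -> R) : zsummable f -> ex_series (bilateral f).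
Proof. intros H. apply ex_series_Rabs, zsummable_ex_abs, H. Qed.

Lemma zsum_halves (f : Z -> R) : zsummable f ->
  zsum f = Series (fun n => f (Z.of_nat n)) + Series (fun n => f (- Z.of_nat n - 1)%Z).
Proof.
  intros H. apply zsummable_halves in H as [H1 H2].
  apply Series_plus; apply ex_series_Rabs; assumption.
Qed.

Lemma zsum_ext (f g : Z -> R) : (forall n, f n = g n) -> zsum f = zsum g.
Proof. intros H. apply Series_ext. intros n. unfold bilateral. now rewrite !H. Qed.

Lemma zsummable_ext (f g : Z -> R) :
  (forall n, f n = g n) -> zsummable f -> zsummable g.
Proof. intros H. apply ex_series_ext. intros n. unfold bilateral. now rewrite !H. Qed.

Lemma zsummable_le (f g : Z -> R) :
  (forall n, Rabs (f n) <= g n) -> zsummable g -> zsummable f.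
Proof.
  intros H Hg. apply (ex_series_le_R _ _) with (2 := Hg). intros n. unfold bilateral.
  rewrite Rabs_pos_eq by (apply Rplus_le_le_0_compat; apply Rabs_pos).
  apply Rplus_le_compat; (eapply Rle_trans; [apply H | apply Rle_abs]).
Qed.

Lemma zsummable_abs (f : Z -> R) : zsummable f -> zsummable (fun n => Rabs (f n)).
Proof.
  apply ex_series_ext. intros n. unfold bilateral. now rewrite !Rabs_Rabsolu.
Qed.

Lemma zsum_scal (c : R) (f : Z -> R) : zsum (fun n => c * f n) = c * zsum f.
Proof.
  unfold zsum. rewrite <- Series_scal_l. apply Series_ext. intros n. unfold bilateral. ring_R.
Qed.

Lemma zsummable_scal (c : R) (f : Z -> R) : zsummable f -> zsummable (fun n => c * f n).
Proof.
  intros H. apply ex_series_ext with (fun n => Rabs c * bilateral (fun n => Rabs (f n)) n).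
  - intros n. unfold bilateral. rewrite !Rabs_mult. ring_R.
  - now apply ex_series_scal_R.
Qed.

Lemma zsum_plus (f g : Z -> R) : zsummable f -> zsummable g ->
  zsum (fun n => f n + g n) = zsum f + zsum g.
Proof.
  intros Hf Hg. unfold zsum.
  rewrite <- Series_plus by (apply zsummable_ex; assumption).
  apply Series_ext. intros n. unfold bilateral. ring_R.
Qed.

Lemma zsum_flip (f : Z -> R) : zsum (fun n => f (- n - 1)%Z) = zsum f.
Proof.
  apply Series_ext. intros n. unfold bilateral.
  replace (- (- Z.of_nat n - 1) - 1)%Z with (Z.of_nat n) by lia. ring_R.
Qed.

Lemma zsummable_flip (f : Z -> R) : zsummable f -> zsummable (fun n => f (- n - 1)%Z).
Proof.
  apply ex_series_ext. intros n. unfold bilateral.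
  replace (- (- Z.of_nat n - 1) - 1)%Z with (Z.of_nat n) by lia. ring_R.
Qed.

(** The shift moves the single term f 0 from one half of Z to the other. *)
Lemma zsum_succ (f : Z -> R) : zsummable f ->
  zsummable (fun n => f (n + 1)%Z) /\ zsum (fun n => f (n + 1)%Z) = zsum f.
Proof.
  intros H. pose proof (proj1 (zsummable_halves f) H) as [H1 H2].
  assert (H' : zsummable (fun n => f (n + 1)%Z)).
  { apply zsummable_halves. split.
    - apply (ex_series_incr_1 (fun n => Rabs (f (Z.of_nat n)))) in H1.
      apply ex_series_ext with (2 := H1). intros n. do 2 f_equal. lia.
    - apply (ex_series_incr_1 (fun n => Rabs (f (- Z.of_nat n - 1 + 1)%Z))).
      apply ex_series_ext with (2 := H2). intros n. do 2 f_equal. lia. }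
  split; [exact H' |].
  rewrite (zsum_halves _ H'), (zsum_halves _ H).
  apply zsummable_halves in H' as [H1' H2'].
  rewrite (Series_incr_1 (fun n => f (Z.of_nat n))) by (apply ex_series_Rabs, H1).
  rewrite (Series_incr_1 (fun n => f (- Z.of_nat n - 1 + 1)%Z)) by (apply ex_series_Rabs, H2').
  rewrite (Series_ext (fun n => f (Z.of_nat n + 1)%Z) (fun n => f (Z.of_nat (S n))))
    by (intros n; f_equal; lia).
  rewrite (Series_ext (fun n => f (- Z.of_nat (S n) - 1 + 1)%Z) (fun n => f (- Z.of_nat n - 1)%Z))
    by (intros n; f_equal; lia).
  simpl. ring_R.
Qed.

Lemma zsum_pred (f : Z -> R) : zsummable f ->
  zsummable (fun n => f (n - 1)%Z) /\ zsum (fun n => f (n - 1)%Z) = zsum f.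
Proof.
  intros H.
  destruct (zsum_succ _ (zsummable_flip f H)) as [H1 H2].
  (* a shift down is a shift up conjugated by the flip *)
  assert (E : forall n, f (- (- n - 1 + 1) - 1)%Z = f (n - 1)%Z) by (intros n; f_equal; lia).
  split.
  - apply zsummable_flip in H1. apply zsummable_ext with (2 := H1). exact E.
  - rewrite <- (zsum_flip f), <- H2, <- (zsum_flip (fun n => f (- (n + 1) - 1)%Z)).
    apply zsum_ext. intros n. now rewrite <- E.
Qed.

Lemma zsum_shift_both (f : Z -> R) (c : Z) : zsummable f ->
  zsummable (fun n => f (n + c)%Z) /\ zsum (fun n => f (n + c)%Z) = zsum f.
Proof.
  intros H. revert c.
  apply Z.bi_induction; [now intros x y -> | |].
  - split.
    + apply zsummable_ext with (2 := H). intros n. f_equal; lia.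
    + apply zsum_ext. intros n. f_equal; lia.
  - intros c. split; intros [H1 H2].
    + destruct (zsum_succ _ H1) as [H3 H4].
      assert (E : forall n, f (n + 1 + c)%Z = f (n + Z.succ c)%Z) by (intros n; f_equal; lia).
      split; [apply zsummable_ext with (1 := E), H3 |].
      now rewrite <- H2, <- H4, (zsum_ext _ _ E).
    + destruct (zsum_pred _ H1) as [H3 H4].
      assert (E : forall n, f (n - 1 + Z.succ c)%Z = f (n + c)%Z) by (intros n; f_equal; lia).
      split; [apply zsummable_ext with (1 := E), H3 |].
      now rewrite <- H2, <- H4, (zsum_ext _ _ E).
Qed.

Lemma zsummable_shift (f : Z -> R) (c : Z) :
  zsummable f -> zsummable (fun n => f (n + c)%Z).
Proof. intros H. now apply zsum_shift_both. Qed.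

Lemma zsum_shift (f : Z -> R) (c : Z) :
  zsummable f -> zsum (fun n => f (n + c)%Z) = zsum f.
Proof. intros H. now apply zsum_shift_both. Qed.

Lemma zsum_reflect (f : Z -> R) (c : Z) :
  zsummable f -> zsum (fun n => f (c - n)%Z) = zsum f.
Proof.
  intros H. rewrite <- (zsum_shift f (c + 1) H), <- (zsum_flip (fun n => f (n + (c + 1))%Z)).
  apply zsum_ext. intros n. f_equal; lia.
Qed.

Lemma Series_pairs (g : nat -> R) : ex_series g ->
  is_series (fun m => g (2 * m)%nat + g (2 * m + 1)%nat) (Series g).
Proof.
  intros H.
  assert (Hl : is_lim_seq (sum_n g) (Series g)) by exact (Series_correct g H).
  change (is_lim_seq (sum_n (fun m => g (2 * m)%nat + g (2 * m + 1)%nat)) (Series g)).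
  apply is_lim_seq_ext with (fun N => sum_n g (2 * N + 1)).
  - induction n as [| n IH].
    + replace (2 * 0 + 1)%nat with 1%nat by lia. now rewrite sum_Sn, !sum_O.
    + replace (2 * S n + 1)%nat with (S (S (2 * n + 1))) by lia.
      rewrite !sum_Sn, IH. unfold plus; simpl.
      replace (S (n + (n + 0) + 1)) with (n + S (n + 0) + 1)%nat by lia.
      replace (n + S (n + 0) + 1)%nat with (S (n + S (n + 0))) at 1 by lia.
      rewrite Rplus_assoc. repeat f_equal; lia.
  - apply (is_lim_seq_subseq (sum_n g) _ (fun N => (2 * N + 1)%nat)); [| exact Hl].
    intros P [N HN]. exists N. intros n Hn. apply HN. lia.
Qed.

Lemma zsummable_parity (f : Z -> R) : zsummable f ->
  zsummable (fun n => f (2 * n)%Z) /\ zsummable (fun n => f (2 * n + 1)%Z).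
Proof.
  intros H. pose proof (ex_intro _ _ (Series_pairs _ H)) as Hp.
  split; (apply (ex_series_le_R _ _) with (2 := Hp); intros m; unfold bilateral;
    rewrite Rabs_pos_eq by (apply Rplus_le_le_0_compat; apply Rabs_pos)).
  - replace (Z.of_nat (2 * m)) with (2 * Z.of_nat m)%Z by lia.
    replace (- Z.of_nat (2 * m + 1) - 1)%Z with (2 * (- Z.of_nat m - 1))%Z by lia.
    pose proof (Rabs_pos (f (- (2 * Z.of_nat m) - 1)%Z)).
    pose proof (Rabs_pos (f (Z.of_nat (2 * m + 1)))). lra.
  - replace (Z.of_nat (2 * m + 1)) with (2 * Z.of_nat m + 1)%Z by lia.
    replace (- Z.of_nat (2 * m) - 1)%Z with (2 * (- Z.of_nat m - 1) + 1)%Z by lia.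
    pose proof (Rabs_pos (f (Z.of_nat (2 * m)))).
    pose proof (Rabs_pos (f (- (2 * Z.of_nat m + 1) - 1)%Z)). lra.
Qed.

(** The pairs of index 2m and 2m+1 of f together hold f at 2m, 2m+1, -2m-1
    and -2m-2, which are the pairs of index m of the two subsums. *)
Lemma zsum_parity (f : Z -> R) : zsummable f ->
  zsum f = zsum (fun n => f (2 * n)%Z) + zsum (fun n => f (2 * n + 1)%Z).
Proof.
  intros H. destruct (zsummable_parity f H) as [He Ho].
  unfold zsum at 1. rewrite <- (is_series_unique _ _ (Series_pairs _ (zsummable_ex _ H))).
  unfold zsum. rewrite <- Series_plus by (apply zsummable_ex; assumption).
  apply Series_ext. intros m. unfold bilateral.
  replace (Z.of_nat (2 * m)) with (2 * Z.of_nat m)%Z by lia.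
  replace (- Z.of_nat (2 * m + 1) - 1)%Z with (2 * (- Z.of_nat m - 1))%Z by lia.
  replace (Z.of_nat (2 * m + 1)) with (2 * Z.of_nat m + 1)%Z by lia.
  replace (2 * (- Z.of_nat m - 1) + 1)%Z with (- (2 * Z.of_nat m) - 1)%Z by lia. ring_R.
Qed.

Lemma zsum_term_le (f : Z -> R) (n : Z) : zsummable f ->
  Rabs (f n) <= zsum (fun n => Rabs (f n)).
Proof.
  intros H.
  assert (Hp : forall m, 0 <= bilateral (fun n => Rabs (f n)) m)
    by (intros m; apply Rplus_le_le_0_compat; apply Rabs_pos).
  destruct (Z_le_gt_dec 0 n).
  - eapply Rle_trans; [| exact (term_le_Series _ (Z.to_nat n) Hp H)].
    unfold bilateral. rewrite Z2Nat.id by assumption.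
    pose proof (Rabs_pos (f (- n - 1)%Z)). lra.
  - eapply Rle_trans; [| exact (term_le_Series _ (Z.to_nat (- n - 1)) Hp H)].
    unfold bilateral. rewrite Z2Nat.id by lia.
    replace (- (- n - 1) - 1)%Z with n by lia.
    pose proof (Rabs_pos (f (- n - 1)%Z)). lra.
Qed.

Lemma zsum_abs_le (f : Z -> R) : zsummable f -> Rabs (zsum f) <= zsum (fun n => Rabs (f n)).
Proof.
  intros H. eapply Rle_trans; [apply Series_Rabs, zsummable_ex_abs, H |].
  apply Series_le; [| exact H].
  intros n. split; [apply Rabs_pos | apply Rabs_triang].
Qed.

(** Both indices are folded at once, so that four values of F make one term of
    a double series over N. *)
Lemma zsum_fubini_aux (F : Z -> Z -> R) :
  (forall m, zsummable (F m)) ->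
  zsummable (fun m => zsum (fun n => Rabs (F m n))) ->
  (forall n, zsummable (fun m => F m n)) /\
  is_series (bilateral (fun n => zsum (fun m => F m n))) (zsum (fun m => zsum (F m))).
Proof.
  intros Hrow Hdom.
  assert (Hcol : forall n, zsummable (fun m => F m n)).
  { intros n. apply zsummable_le with (2 := Hdom). intros m.
    exact (zsum_term_le (F m) n (Hrow m)). }
  split; [exact Hcol |].
  pose (a := fun i j => bilateral (fun m => bilateral (F m) j) i).
  assert (HA : forall i, ex_series (bilateral (fun n => bilateral (fun m => Rabs (F m n)) i))).
  { intros i. unfold bilateral at 2.
    apply ex_series_ext with (fun j => bilateral (fun n => Rabs (F (Z.of_nat i) n)) j
      + bilateral (fun n => Rabs (F (- Z.of_nat i - 1)%Z n)) j).
    - intros j. unfold bilateral. ring_R.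
    - apply ex_series_plus_R; apply Hrow. }
  assert (Ha : forall i j, Rabs (a i j) <= bilateral (fun n => bilateral (fun m => Rabs (F m n)) i) j).
  { intros i j. unfold a, bilateral.
    eapply Rle_trans; [apply Rabs_triang |].
    pose proof (Rabs_triang (F (Z.of_nat i) (Z.of_nat j)) (F (Z.of_nat i) (- Z.of_nat j - 1)%Z)).
    pose proof (Rabs_triang (F (- Z.of_nat i - 1)%Z (Z.of_nat j))
      (F (- Z.of_nat i - 1)%Z (- Z.of_nat j - 1)%Z)). lra. }
  assert (Hser : is_series (fun j => Series (fun i => a i j)) (Series (fun i => Series (a i)))).
  { apply Series_fubini.
    - intros i. apply (ex_series_le_R _ _) with (2 := HA i). intros j.
      rewrite Rabs_Rabsolu. apply Ha.
    - apply (ex_series_le_R _ _) with (2 := Hdom). intros i.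
      rewrite Rabs_pos_eq.
      2:{ apply Series_ge_0; [intros; apply Rabs_pos |].
          apply (ex_series_le_R _ _) with (2 := HA i). intros j.
          rewrite Rabs_Rabsolu. apply Ha. }
      apply Rle_trans with (Series (bilateral (fun n => bilateral (fun m => Rabs (F m n)) i))).
      { apply Series_le; [| apply HA]. intros j. split; [apply Rabs_pos | apply Ha]. }
      right. unfold bilateral at 3.
      rewrite !Rabs_pos_eq by (apply Series_ge_0; [intros; apply Rplus_le_le_0_compat;
        apply Rabs_pos | apply Hrow]).
      unfold zsum. rewrite <- Series_plus by apply Hrow.
      apply Series_ext. intros j. unfold bilateral. ring_R. }
  replace (zsum (fun m => zsum (F m))) with (Series (fun i => Series (a i))).
  - apply is_series_ext with (2 := Hser). intros j.
    unfold bilateral at 1, zsum.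
    rewrite <- Series_plus by (apply zsummable_ex, Hcol).
    apply Series_ext. intros i. unfold a, bilateral. ring_R.
  - unfold zsum at 1. apply Series_ext. intros i. unfold bilateral at 1, zsum.
    rewrite <- Series_plus by (apply zsummable_ex, Hrow). reflexivity.
Qed.

Lemma zsum_fubini (F : Z -> Z -> R) :
  (forall m, zsummable (F m)) ->
  zsummable (fun m => zsum (fun n => Rabs (F m n))) ->
  zsummable (fun n => zsum (fun m => F m n)) /\
  zsum (fun m => zsum (F m)) = zsum (fun n => zsum (fun m => F m n)).
Proof.
  intros Hrow Hdom. destruct (zsum_fubini_aux F Hrow Hdom) as [Hcol Hser].
  split; [| symmetry; apply is_series_unique, Hser].
  destruct (zsum_fubini_aux (fun m n => Rabs (F m n))) as [_ Habs].
  - intros m. apply zsummable_abs, Hrow.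
  - apply zsummable_ext with (2 := Hdom). intros m. apply zsum_ext. intros n.
    now rewrite Rabs_Rabsolu.
  - assert (Hs : zsummable (fun n => zsum (fun m => Rabs (F m n)))).
    { eexists. apply is_series_ext with (2 := Habs). intros n. unfold bilateral at 1 2.
      rewrite !Rabs_pos_eq by (apply Series_ge_0; [intros; apply Rplus_le_le_0_compat;
        apply Rabs_pos | apply Hcol]). reflexivity. }
    apply zsummable_le with (2 := Hs). intros n. apply zsum_abs_le, Hcol.
Qed.

(** Summation along the diagonals m + n = d.  The quadratic relations between
    theta values follow from it by treating even and odd d separately. *)
Lemma zsum_convolution (a b : Z -> R) : zsummable a -> zsummable b ->
  zsummable (fun d => zsum (fun m => a m * b (d - m)%Z)) /\
  zsum a * zsum b = zsum (fun d => zsum (fun m => a m * b (d - m)%Z)).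
Proof.
  intros Ha Hb.
  assert (Hshift : forall m, zsummable (fun d => b (d - m)%Z)).
  { intros m. exact (zsummable_shift b (- m) Hb). }
  destruct (zsum_fubini (fun m d => a m * b (d - m)%Z)) as [H1 H2].
  - intros m. apply zsummable_scal, Hshift.
  - apply zsummable_ext with (fun m => zsum (fun n => Rabs (b n)) * Rabs (a m)).
    + intros m.
      rewrite (zsum_ext (fun d => Rabs (a m * b (d - m)%Z))
        (fun d => Rabs (a m) * Rabs (b (d - m)%Z))) by (intros; apply Rabs_mult).
      rewrite zsum_scal.
      rewrite (zsum_shift (fun n => Rabs (b n)) (- m) (zsummable_abs _ Hb)
        : zsum (fun d => Rabs (b (d - m)%Z)) = _). ring_R.
    + apply zsummable_scal, zsummable_abs, Ha.
  - split; [exact H1 |]. rewrite <- H2.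
    rewrite (zsum_ext (fun m => zsum (fun d => a m * b (d - m)%Z)) (fun m => zsum b * a m)).
    + rewrite zsum_scal. ring_R.
    + intros m. rewrite zsum_scal.
      rewrite (zsum_shift b (- m) Hb : zsum (fun d => b (d - m)%Z) = _). ring_R.
Qed.

Lemma zsummable_convolution_term (a b : Z -> R) (d : Z) :
  zsummable a -> zsummable b -> zsummable (fun m => a m * b (d - m)%Z).
Proof.
  intros Ha Hb.
  apply zsummable_le with (fun m => zsum (fun n => Rabs (b n)) * Rabs (a m)).
  - intros m. rewrite Rabs_mult, Rmult_comm.
    apply Rmult_le_compat_r; [apply Rabs_pos | now apply zsum_term_le].
  - now apply zsummable_scal, zsummable_abs.
Qed.

(** * Integer powers, theta functions and a Lambert series *)

Lemma powerRZ_Rabs (q : R) (n : Z) : Rabs (powerRZ q n) = powerRZ (Rabs q) n.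
Proof.
  destruct n; simpl.
  - apply Rabs_R1.
  - now rewrite RPow_abs.
  - now rewrite Rabs_inv, RPow_abs.
Qed.

Lemma powerRZ_antitone (r : R) (a b : Z) :
  0 < r < 1 -> (a <= b)%Z -> powerRZ r b <= powerRZ r a.
Proof.
  intros Hr Hab. replace b with (a + Z.of_nat (Z.to_nat (b - a)))%Z by lia.
  rewrite powerRZ_add, <- pow_powerRZ by lra.
  rewrite <- (Rmult_1_r (powerRZ r a)) at 2.
  apply Rmult_le_compat_l; [apply powerRZ_le; lra |].
  rewrite <- (pow1 (Z.to_nat (b - a))). apply pow_incr. lra.
Qed.

Lemma powerRZ_even (q : R) (n : Z) : powerRZ q (2 * n) = powerRZ (q ^ 2) n.
Proof.
  replace (q ^ 2) with (q * q) by ring. rewrite powerRZ_mult.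
  destruct (Req_dec q 0) as [-> | Hq].
  - destruct n; simpl; [ring | |]; rewrite ?Pos2Nat.inj_xO;
      rewrite !pow_i by lia; rewrite ?Rinv_0; ring.
  - rewrite <- powerRZ_add by assumption. f_equal. lia.
Qed.

Lemma powerRZ_m1_even (n : Z) : powerRZ (-1) (2 * n) = 1.
Proof. rewrite powerRZ_even. replace ((-1) ^ 2) with 1 by ring. apply powerRZ_R1. Qed.

Lemma powerRZ_m1_odd (n : Z) : powerRZ (-1) (2 * n + 1) = -1.
Proof. rewrite powerRZ_add, powerRZ_m1_even by lra. simpl. ring. Qed.

Lemma powerRZ_opp_base (q : R) (n : Z) : powerRZ (- q) n = powerRZ (-1) n * powerRZ q n.
Proof. rewrite <- powerRZ_mult. f_equal. ring. Qed.

Lemma powerRZ_m1_opp (n : Z) : powerRZ (-1) (- n) = powerRZ (-1) n.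
Proof. rewrite powerRZ_neg', <- powerRZ_inv'. f_equal. lra. Qed.

(** Pairing n with -n instead, the term at 0 stands alone. *)
Lemma zsum_center (f : Z -> R) : zsummable f ->
  ex_series (fun n => Rabs (f (Z.of_nat (S n)) + f (- Z.of_nat (S n))%Z)) /\
  zsum f = f 0%Z + Series (fun n => f (Z.of_nat (S n)) + f (- Z.of_nat (S n))%Z).
Proof.
  intros H. pose proof (proj1 (zsummable_halves f) H) as [H1 H2].
  pose proof (proj1 (ex_series_incr_1 (fun n => Rabs (f (Z.of_nat n)))) H1) as H1'.
  assert (E : forall n, f (- Z.of_nat n - 1)%Z = f (- Z.of_nat (S n))%Z)
    by (intros n; f_equal; lia).
  assert (H2' : ex_series (fun n => Rabs (f (- Z.of_nat (S n))%Z))).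
  { apply ex_series_ext with (2 := H2). intros n. now rewrite E. }
  split.
  - apply (ex_series_le_R _ _) with (2 := ex_series_plus_R _ _ H1' H2').
    intros n. rewrite Rabs_Rabsolu. apply Rabs_triang.
  - rewrite (zsum_halves f H), (Series_ext _ _ E).
    rewrite (Series_incr_1 (fun n => f (Z.of_nat n))) by (apply ex_series_Rabs, H1).
    rewrite Series_plus; [simpl; ring | apply ex_series_Rabs, H1' | apply ex_series_Rabs, H2'].
Qed.

Lemma zsummable_geom (r : R) : 0 < r < 1 -> zsummable (fun n => powerRZ r (Z.abs n)).
Proof.
  intros Hr.
  assert (Hg : ex_series (fun n => r ^ n)) by (apply ex_series_geom; rewrite Rabs_pos_eq; lra).
  apply zsummable_halves. split.
  - apply ex_series_ext with (2 := Hg). intros n.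
    replace (Z.abs (Z.of_nat n)) with (Z.of_nat n) by lia.
    rewrite <- pow_powerRZ, Rabs_pos_eq; [reflexivity | apply pow_le; lra].
  - apply ex_series_incr_1 in Hg. apply ex_series_ext with (2 := Hg). intros n.
    replace (Z.abs (- Z.of_nat n - 1)) with (Z.of_nat (S n)) by lia.
    rewrite <- pow_powerRZ, Rabs_pos_eq; [reflexivity | apply pow_le; lra].
Qed.

Lemma zsummable_decay (f : Z -> R) (C r : R) : 0 < r < 1 ->
  (forall n, Rabs (f n) <= C * powerRZ r (Z.abs n)) -> zsummable f.
Proof.
  intros Hr H. apply zsummable_le with (1 := H). now apply zsummable_scal, zsummable_geom.
Qed.

(** The value at 0 is the leading term as r tends to 0. *)
Lemma zsum_decay_near (f : Z -> R) (r : R) : 0 < r < 1 ->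
  (forall n, Rabs (f n) <= powerRZ r (Z.abs n)) ->
  Rabs (zsum f - f 0%Z) <= 2 * r / (1 - r).
Proof.
  intros Hr H.
  assert (Hs : zsummable f).
  { apply (zsummable_decay f 1 r Hr). intros n. rewrite Rmult_1_l. apply H. }
  destruct (zsum_center f Hs) as [Hex ->].
  replace (f 0%Z + _ - f 0%Z) with
    (Series (fun n => f (Z.of_nat (S n)) + f (- Z.of_nat (S n))%Z)) by ring.
  eapply Rle_trans; [apply Series_Rabs, Hex |].
  replace (2 * r / (1 - r)) with (Series (fun n => 2 * r * r ^ n)).
  - apply Series_le.
    + intros n. split; [apply Rabs_pos |].
      eapply Rle_trans; [apply Rabs_triang |].
      pose proof (H (Z.of_nat (S n))) as A1. pose proof (H (- Z.of_nat (S n))%Z) as A2.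
      replace (Z.abs (Z.of_nat (S n))) with (Z.of_nat (S n)) in A1 by lia.
      replace (Z.abs (- Z.of_nat (S n))) with (Z.of_nat (S n)) in A2 by lia.
      rewrite <- pow_powerRZ in A1, A2. simpl in A1, A2 |- *. lra.
    + apply ex_series_scal_R, ex_series_geom. rewrite Rabs_pos_eq; lra.
  - rewrite Series_scal_l, Series_geom by (rewrite Rabs_pos_eq; lra). reflexivity.
Qed.

Lemma zsum_ge_term (f : Z -> R) : zsummable f -> (forall n, 0 <= f n) ->
  forall n, f n <= zsum f.
Proof.
  intros H Hp n. rewrite <- (Rabs_pos_eq (f n)) by apply Hp.
  eapply Rle_trans; [apply zsum_term_le, H |].
  right. apply zsum_ext. intros m. apply Rabs_pos_eq, Hp.
Qed.

Definition phi (q : R) : R := zsum (fun n => powerRZ q (n * n)).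
(** The exponents 2n^2 - n are the triangular numbers, each taken once. *)
Definition psi (q : R) : R := zsum (fun n => powerRZ q (2 * n * n - n)).

(** Since q^(-j) / (1 + q^(-4j)) = q^(3j) / (1 + q^(4j)), this is
    1 + 2 sum_(j >= 1) (q^j + q^(3j)) / (1 + q^(4j)). *)
Definition lambert (q : R) : R :=
  2 * zsum (fun j => powerRZ q j / (1 + powerRZ q (4 * j))).

Section Theta.
Variable q : R.
Hypothesis Hq : 0 < Rabs q < 1.

Let Hq0 : q <> 0.
Proof. intros E. rewrite E, Rabs_R0 in Hq. lra. Qed.

Lemma powerRZ_4_pos (j : Z) : 0 < powerRZ q (4 * j).
Proof.
  replace (4 * j)%Z with (2 * (2 * j))%Z by ring.
  rewrite powerRZ_even. apply powerRZ_lt. apply pow2_gt_0, Hq0.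
Qed.

Lemma phi_term_bound (n : Z) : Rabs (powerRZ q (n * n)) <= powerRZ (Rabs q) (Z.abs n).
Proof. rewrite powerRZ_Rabs. apply powerRZ_antitone; [exact Hq | nia]. Qed.

Lemma phi_summable : zsummable (fun n => powerRZ q (n * n)).
Proof.
  apply (zsummable_decay _ 1 (Rabs q) Hq). intros n. rewrite Rmult_1_l. apply phi_term_bound.
Qed.

Lemma psi_summable : zsummable (fun n => powerRZ q (2 * n * n - n)).
Proof.
  apply (zsummable_decay _ 1 (Rabs q) Hq). intros n. rewrite Rmult_1_l, powerRZ_Rabs.
  apply powerRZ_antitone; [exact Hq | nia].
Qed.

Lemma lambert_term_bound (j : Z) :
  Rabs (powerRZ q j / (1 + powerRZ q (4 * j))) <= powerRZ (Rabs q) (Z.abs j).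
Proof.
  pose proof (powerRZ_4_pos j) as Hp.
  unfold Rdiv. rewrite Rabs_mult, powerRZ_Rabs, Rabs_inv, (Rabs_pos_eq (1 + _)) by lra.
  assert (Hpow : 0 < powerRZ (Rabs q) j) by (apply powerRZ_lt; lra).
  destruct (Z_le_gt_dec 0 j).
  - replace (Z.abs j) with j by lia. rewrite <- (Rmult_1_r (powerRZ _ _)) at 2.
    apply Rmult_le_compat_l; [lra |]. rewrite <- Rinv_1. apply Rinv_le_contravar; lra.
  - (* for j < 0 the denominator is at least q^(4j), hence at least q^(2j) *)
    replace (powerRZ (Rabs q) (Z.abs j)) with
      (powerRZ (Rabs q) j * powerRZ (Rabs q) (- (2 * j))).
    2:{ rewrite <- powerRZ_add by lra. f_equal. lia. }
    apply Rmult_le_compat_l; [lra |]. rewrite powerRZ_neg'.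
    apply Rinv_le_contravar; [apply powerRZ_lt; lra |].
    replace (powerRZ q (4 * j)) with (Rabs (powerRZ q (4 * j))) by (apply Rabs_pos_eq; lra).
    rewrite powerRZ_Rabs.
    pose proof (powerRZ_antitone (Rabs q) (4 * j) (2 * j) Hq ltac:(lia)). lra.
Qed.

Lemma lambert_summable : zsummable (fun j => powerRZ q j / (1 + powerRZ q (4 * j))).
Proof.
  apply (zsummable_decay _ 1 (Rabs q) Hq). intros n. rewrite Rmult_1_l. apply lambert_term_bound.
Qed.

Lemma phi_near_0 : Rabs (phi q - 1) <= 2 * Rabs q / (1 - Rabs q).
Proof. exact (zsum_decay_near _ _ Hq phi_term_bound). Qed.

Lemma lambert_near_0 : Rabs (lambert q - 1) <= 4 * Rabs q / (1 - Rabs q).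
Proof.
  pose proof (zsum_decay_near _ _ Hq lambert_term_bound) as H.
  cbv beta in H. unfold lambert. rewrite Z.mul_0_r, powerRZ_O in H.
  match goal with |- Rabs (2 * ?s - 1) <= _ =>
    replace (2 * s - 1) with (2 * (s - 1 / (1 + 1))) by field end.
  rewrite Rabs_mult, (Rabs_pos_eq 2) by lra.
  replace (4 * Rabs q / (1 - Rabs q)) with (2 * (2 * Rabs q / (1 - Rabs q))) by (field; lra).
  apply Rmult_le_compat_l; [lra | exact H].
Qed.

End Theta.

Lemma abs_opp_lt_1 (q : R) : 0 < Rabs q < 1 -> 0 < Rabs (- q) < 1.
Proof. now rewrite Rabs_Ropp. Qed.

Lemma abs_neq_0 (q : R) : 0 < Rabs q < 1 -> q <> 0.
Proof. intros H E. rewrite E, Rabs_R0 in H. lra. Qed.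

(** * Quadratic relations between theta values *)

Lemma zsum_antisymmetric (f : Z -> R) (c : Z) :
  zsummable f -> (forall n, f (c - n)%Z = - f n) -> zsum f = 0.
Proof.
  intros H Hf. pose proof (zsum_reflect f c H) as E.
  rewrite (zsum_ext _ (fun n => -1 * f n)) in E by (intros n; rewrite Hf; ring).
  rewrite zsum_scal in E. lra.
Qed.

(** Centering m at u turns m^2 + (2u - m)^2 into 2 u^2 + 2 m^2. *)
Lemma phi_conv_even (q : R) (u : Z) : 0 < Rabs q < 1 ->
  zsum (fun m => powerRZ q (m * m) * powerRZ q ((2 * u - m) * (2 * u - m)))
  = powerRZ (q ^ 2) (u * u) * phi (q ^ 2).
Proof.
  intros Hq. pose proof (abs_neq_0 q Hq) as Hq0.
  rewrite <- (zsum_shift _ u (zsummable_convolution_term _ _ (2 * u)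
    (phi_summable q Hq) (phi_summable q Hq))).
  unfold phi. rewrite <- zsum_scal. apply zsum_ext. intros m.
  rewrite <- !powerRZ_even, <- !powerRZ_add by assumption. f_equal. ring.
Qed.

(** On the diagonal m + n = d the exponent m^2 + n^2 has the parity of d, so
    replacing q by -q keeps the even diagonals and negates the odd ones. *)
Lemma phi_sqr_add (q : R) : 0 < Rabs q < 1 ->
  phi q ^ 2 + phi (- q) ^ 2 = 2 * phi (q ^ 2) ^ 2.
Proof.
  intros Hq. pose proof (abs_neq_0 q Hq) as Hq0. pose proof (abs_opp_lt_1 q Hq) as Hq'.
  destruct (zsum_convolution _ _ (phi_summable q Hq) (phi_summable q Hq)) as [S1 E1].
  destruct (zsum_convolution _ _ (phi_summable (- q) Hq') (phi_summable (- q) Hq')) as [S2 E2].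
  fold (phi q) in E1. fold (phi (- q)) in E2. cbv beta in *.
  rewrite (zsum_parity _ S1) in E1. rewrite (zsum_parity _ S2) in E2.
  rewrite (zsum_ext _ _ (fun u => phi_conv_even q u Hq)) in E1.
  rewrite (zsum_ext _ _ (fun u => phi_conv_even (- q) u Hq')) in E2.
  replace ((- q) ^ 2) with (q ^ 2) in E2 by ring.
  (* the odd diagonals cancel *)
  match type of E1 with _ = _ + ?x => match type of E2 with _ = _ + ?y =>
    assert (Hodd : y = -1 * x) end end.
  { rewrite <- zsum_scal. apply zsum_ext. intros u.
    rewrite <- zsum_scal. apply zsum_ext. intros m.
    rewrite <- !powerRZ_add by (auto using Ropp_neq_0_compat).
    rewrite powerRZ_opp_base. f_equal.
    etransitivity; [| exact (powerRZ_m1_odd (m * m - (2 * u + 1) * m + 2 * u * u + 2 * u))].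
    f_equal. ring. }
  rewrite Hodd in E2.
  rewrite (zsum_ext _ (fun u => phi (q ^ 2) * powerRZ (q ^ 2) (u * u))) in E1, E2
    by (intros; ring).
  rewrite zsum_scal in E1, E2. fold (phi (q ^ 2)) in E1, E2.
  replace (phi q ^ 2) with (phi q * phi q) by ring.
  replace (phi (- q) ^ 2) with (phi (- q) * phi (- q)) by ring.
  rewrite E1, E2. ring.
Qed.

(** The sign (-1)^n is antisymmetric under the exchange of m and n on an odd
    diagonal, whose sum is therefore 0.  On the diagonal 2u it factors as
    (-1)^u (-1)^m after m is centered at u. *)
Lemma phi_mul_opp (q : R) : 0 < Rabs q < 1 ->
  phi q * phi (- q) = phi (- q ^ 2) ^ 2.
Proof.
  intros Hq. pose proof (abs_neq_0 q Hq) as Hq0. pose proof (abs_opp_lt_1 q Hq) as Hq'.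
  destruct (zsum_convolution _ _ (phi_summable q Hq) (phi_summable (- q) Hq')) as [S1 E1].
  fold (phi q) (phi (- q)) in E1. rewrite E1.
  cbv beta in *. rewrite (zsum_parity _ S1).
  rewrite (zsum_ext (fun u => zsum _) (fun u => phi (- q ^ 2) * powerRZ (- q ^ 2) (u * u))).
  2:{ intros u.
    rewrite <- (zsum_shift _ u (zsummable_convolution_term _ _ (2 * u)
      (phi_summable q Hq) (phi_summable (- q) Hq'))).
    unfold phi. rewrite Rmult_comm, <- zsum_scal. apply zsum_ext. intros m.
    rewrite !powerRZ_opp_base, <- !powerRZ_even.
    replace (powerRZ (-1) ((2 * u - (m + u)) * (2 * u - (m + u))))
      with (powerRZ (-1) (u * u) * powerRZ (-1) (m * m)).
    2:{ rewrite <- powerRZ_add by lra.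
        replace (u * u + m * m)%Z with
          ((2 * u - (m + u)) * (2 * u - (m + u)) + 2 * (u * m))%Z by ring.
        rewrite powerRZ_add, powerRZ_m1_even by lra. ring. }
    transitivity (powerRZ (-1) (u * u) * powerRZ (-1) (m * m) *
      (powerRZ q (2 * (u * u)) * powerRZ q (2 * (m * m)))); [| ring].
    rewrite (Rmult_comm (powerRZ q _)), Rmult_assoc. f_equal.
    rewrite <- !powerRZ_add by assumption. f_equal. ring. }
  rewrite zsum_scal. fold (phi (- q ^ 2)).
  rewrite (zsum_ext (fun u => zsum _) (fun u => 0 * powerRZ q (u * u))).
  { rewrite zsum_scal. ring. }
  intros u. rewrite Rmult_0_l.
  apply (zsum_antisymmetric _ (2 * u + 1)).
  { exact (zsummable_convolution_term _ _ (2 * u + 1)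
      (phi_summable q Hq) (phi_summable (- q) Hq')). }
  intros m. rewrite !powerRZ_opp_base.
  replace (2 * u + 1 - (2 * u + 1 - m))%Z with m by ring.
  replace (powerRZ (-1) (m * m))
    with (- powerRZ (-1) ((2 * u + 1 - m) * (2 * u + 1 - m))); [ring |].
  replace (m * m)%Z with ((2 * u + 1 - m) * (2 * u + 1 - m)
    + (2 * ((2 * u + 1) * m - 2 * u * u - 2 * u - 1) + 1))%Z by ring.
  rewrite powerRZ_add, powerRZ_m1_odd by lra. ring.
Qed.

(** Only the even squares (2n)^2 = 4 n^2 survive. *)
Lemma phi_add (q : R) : 0 < Rabs q < 1 -> phi q + phi (- q) = 2 * phi (q ^ 4).
Proof.
  intros Hq. pose proof (abs_opp_lt_1 q Hq) as Hq'.
  unfold phi at 1 2.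
  rewrite (zsum_parity _ (phi_summable q Hq)), (zsum_parity _ (phi_summable (- q) Hq')).
  cbv beta.
  rewrite (zsum_ext (fun n => powerRZ (- q) (2 * n * (2 * n)))
    (fun n => powerRZ q (2 * n * (2 * n)))).
  2:{ intros n. rewrite powerRZ_opp_base.
    replace (2 * n * (2 * n))%Z with (2 * (2 * n * n))%Z by ring.
    rewrite powerRZ_m1_even. ring. }
  rewrite (zsum_ext (fun n => powerRZ (- q) ((2 * n + 1) * (2 * n + 1)))
    (fun n => -1 * powerRZ q ((2 * n + 1) * (2 * n + 1)))).
  2:{ intros n. rewrite powerRZ_opp_base. f_equal.
    etransitivity; [| exact (powerRZ_m1_odd (2 * n * n + 2 * n))]. f_equal. ring. }
  rewrite zsum_scal.
  unfold phi. rewrite (zsum_ext (fun n => powerRZ (q ^ 4) (n * n))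
    (fun n => powerRZ q (2 * n * (2 * n)))); [ring |].
  intros n. replace (q ^ 4) with ((q ^ 2) ^ 2) by ring.
  rewrite <- !powerRZ_even. f_equal. ring.
Qed.

(** With d = m + n, the exponent 2m^2 - m + 2n^2 - n is
    d^2 - d + (m - n)^2.  Both d = 2b and d = 1 - 2b give d^2 - d = 4b^2 - 2b;
    the former leaves the even squares in m - n, the latter the odd ones. *)
Lemma psi_sqr (q : R) : 0 < Rabs q < 1 -> psi q ^ 2 = phi q * psi (q ^ 2).
Proof.
  intros Hq. pose proof (abs_neq_0 q Hq) as Hq0.
  destruct (zsum_convolution _ _ (psi_summable q Hq) (psi_summable q Hq)) as [S1 E1].
  fold (psi q) in E1. replace (psi q ^ 2) with (psi q * psi q) by ring. rewrite E1.
  destruct (zsummable_parity _ S1) as [_ So].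
  rewrite (zsum_parity _ S1), <- (zsum_reflect _ 0 So).
  cbv beta. unfold phi. rewrite (zsum_parity _ (phi_summable q Hq)). cbv beta.
  rewrite Rmult_plus_distr_r. unfold psi. rewrite <- !zsum_scal.
  f_equal; apply zsum_ext; intros b.
  - rewrite <- (zsum_shift _ b (zsummable_convolution_term _ _ (2 * b)
      (psi_summable q Hq) (psi_summable q Hq))).
    rewrite Rmult_comm, <- zsum_scal. apply zsum_ext. intros m.
    rewrite <- powerRZ_even, <- !powerRZ_add by assumption. f_equal. ring.
  - rewrite <- (zsum_shift _ (1 - b) (zsummable_convolution_term _ _ (2 * (0 - b) + 1)
      (psi_summable q Hq) (psi_summable q Hq))).
    rewrite Rmult_comm, <- zsum_scal. apply zsum_ext. intros m.
    rewrite <- powerRZ_even, <- !powerRZ_add by assumption. f_equal. ring.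
Qed.

(** * A case of Kronecker's product formula *)

(** The factor of q^d in the d-th diagonal sum of the product of psi (-q) and
    sum_j q^j / (1 + q^(4j)). *)
Definition kronecker_coef (q : R) (d : Z) : R :=
  zsum (fun m => powerRZ (-1) m * powerRZ q (2 * (m * (m - 1)))
                 / (1 + powerRZ q (4 * (d - m)))).

Lemma Zabs_pred_le (m : Z) : (- 1 + Z.abs m <= 2 * (m * (m - 1)))%Z.
Proof. destruct (Z_le_gt_dec m 0); [nia |]. replace (Z.abs m) with m by lia. nia. Qed.

Section Kronecker.
Variable q : R.
Hypothesis Hq : 0 < Rabs q < 1.
Let Hq0 : q <> 0 := abs_neq_0 q Hq.

Lemma kronecker_coef_summable (d : Z) :
  zsummable (fun m => powerRZ (-1) m * powerRZ q (2 * (m * (m - 1)))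
                      / (1 + powerRZ q (4 * (d - m)))).
Proof.
  apply (zsummable_decay _ (/ Rabs q) (Rabs q) Hq). intros m.
  pose proof (powerRZ_4_pos q Hq (d - m)) as Hp.
  unfold Rdiv. rewrite !Rabs_mult, !powerRZ_Rabs, Rabs_inv, (Rabs_pos_eq (1 + _)) by lra.
  rewrite Rabs_m1, powerRZ_R1, Rmult_1_l.
  rewrite <- (powerRZ_1 (Rabs q)) at 2. rewrite <- powerRZ_neg', <- powerRZ_add by lra.
  rewrite <- (Rmult_1_r (powerRZ (Rabs q) (- _ + _))).
  apply Rmult_le_compat.
  - apply powerRZ_le; lra.
  - left. apply Rinv_0_lt_compat. lra.
  - apply powerRZ_antitone; [exact Hq | apply Zabs_pred_le].
  - rewrite <- Rinv_1. apply Rinv_le_contravar; lra.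
Qed.

(** The exchange of m and 1 - m preserves m (m - 1) and changes the sign. *)
Lemma alternating_theta_zero :
  zsum (fun m => powerRZ (-1) m * powerRZ q (2 * (m * (m - 1)))) = 0.
Proof.
  apply (zsum_antisymmetric _ 1).
  - apply (zsummable_decay _ (/ Rabs q) (Rabs q) Hq). intros m.
    rewrite Rabs_mult, !powerRZ_Rabs, Rabs_m1, powerRZ_R1, Rmult_1_l.
    rewrite <- (powerRZ_1 (Rabs q)) at 2. rewrite <- powerRZ_neg', <- powerRZ_add by lra.
    apply powerRZ_antitone; [exact Hq | apply Zabs_pred_le].
  - intros m. unfold Z.sub at 1. rewrite powerRZ_add, powerRZ_m1_opp, powerRZ_1 by lra.
    replace ((1 - m) * (1 - m - 1))%Z with (m * (m - 1))%Z by ring. ring.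
Qed.

(** If t m / D m are the terms of the coefficient d + 1, the terms
    t m (D m - 1) / D m are, up to the factor - q^(4d) and an index shift, those
    of the coefficient d.  The two families add up to sum_m t m = 0. *)
Lemma kronecker_coef_succ (d : Z) :
  kronecker_coef q (d + 1) = powerRZ q (4 * d) * kronecker_coef q d.
Proof.
  set (t := fun m => powerRZ (-1) m * powerRZ q (2 * (m * (m - 1)))).
  set (D := fun m => 1 + powerRZ q (4 * (d + 1 - m))).
  assert (HD : forall m, 0 < D m - 1) by (intros m; unfold D;
    pose proof (powerRZ_4_pos q Hq (d + 1 - m)); lra).
  assert (Hs : zsummable (fun m => t m / D m)) by exact (kronecker_coef_summable (d + 1)).
  assert (Hd : forall m, t (m - 1)%Z / (1 + powerRZ q (4 * (d - (m - 1)))) * powerRZ q (4 * d)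
      = -1 * (t m / D m * (D m - 1))).
  { intros m. unfold t, D. replace (d - (m - 1))%Z with (d + 1 - m)%Z by ring.
    unfold Rdiv. set (i := / _).
    replace (1 + powerRZ q (4 * (d + 1 - m)) - 1) with (powerRZ q (4 * (d + 1 - m))) by ring.
    replace (powerRZ (-1) m) with (- powerRZ (-1) (m - 1)).
    2:{ replace m with (m - 1 + 1)%Z at 2 by ring. rewrite powerRZ_add, powerRZ_1 by lra. ring. }
    transitivity (powerRZ (-1) (m - 1) * i *
      (powerRZ q (2 * ((m - 1) * (m - 1 - 1))) * powerRZ q (4 * d))); [ring |].
    transitivity (powerRZ (-1) (m - 1) * i *
      (powerRZ q (2 * (m * (m - 1))) * powerRZ q (4 * (d + 1 - m)))); [| ring].
    rewrite <- !powerRZ_add by assumption. do 2 f_equal. ring. }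
  pose proof (zsum_pred _ (kronecker_coef_summable d)) as [Hsp Ep].
  fold (kronecker_coef q d) in Ep. rewrite <- Ep, <- zsum_scal. cbv beta in Hsp |- *.
  rewrite (zsum_ext _ (fun m => -1 * (t m / D m * (D m - 1)))).
  2:{ intros m. rewrite <- Hd. unfold t. ring. }
  assert (Hs2 : zsummable (fun m => t m / D m * (D m - 1))).
  { apply (zsummable_scal (- powerRZ q (4 * d))) in Hsp.
    apply zsummable_ext with (2 := Hsp). intros m. cbv beta.
    replace (t m / D m * (D m - 1)) with (-1 * (-1 * (t m / D m * (D m - 1)))) by ring.
    rewrite <- Hd. unfold t. ring. }
  rewrite zsum_scal.
  pose proof (zsum_plus _ _ Hs Hs2) as E.
  rewrite (zsum_ext _ t) in E.
  2:{ intros m. specialize (HD m). field. lra. }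
  unfold t at 1 in E. rewrite alternating_theta_zero in E.
  change (kronecker_coef q (d + 1)) with (zsum (fun m => t m / D m)). lra.
Qed.

Lemma kronecker_coef_closed (d : Z) : kronecker_coef q d = powerRZ q (2 * (d * (d - 1))) * kronecker_coef q 0.
Proof.
  revert d. apply Z.bi_induction.
  - now intros x y ->.
  - rewrite Z.mul_0_l, Z.mul_0_r, powerRZ_O. ring.
  - intros d. unfold Z.succ. rewrite kronecker_coef_succ.
    replace (2 * ((d + 1) * (d + 1 - 1)))%Z with (4 * d + 2 * (d * (d - 1)))%Z by ring.
    rewrite powerRZ_add, Rmult_assoc by assumption.
    split; intros H; [now rewrite H |].
    apply Rmult_eq_reg_l in H; [exact H | apply powerRZ_NOR, Hq0].
Qed.

(** By [kronecker_coef_closed] the diagonal sums are q^(2d^2 - d) times a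
    constant: the product is again a theta series. *)
Lemma psi_opp_mul_lambert : psi (- q) * lambert q = 2 * kronecker_coef q 0 * psi q.
Proof.
  pose proof (abs_opp_lt_1 q Hq) as Hq'.
  destruct (zsum_convolution _ _ (psi_summable (- q) Hq') (lambert_summable q Hq)) as [_ E].
  fold (psi (- q)) in E. unfold lambert.
  rewrite <- Rmult_assoc, (Rmult_comm (psi _)), Rmult_assoc, E, Rmult_assoc. f_equal.
  unfold psi. rewrite <- zsum_scal. apply zsum_ext. intros d.
  replace (2 * d * d - d)%Z with (d + 2 * (d * (d - 1)))%Z by ring.
  rewrite powerRZ_add by assumption.
  rewrite <- Rmult_assoc, (Rmult_comm (kronecker_coef q 0)), Rmult_assoc, (Rmult_comm (kronecker_coef q 0)).
  rewrite <- kronecker_coef_closed. unfold kronecker_coef. rewrite <- zsum_scal.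
  apply zsum_ext. intros m. unfold Rdiv. rewrite <- !Rmult_assoc. f_equal.
  rewrite powerRZ_opp_base.
  replace (powerRZ (-1) (2 * m * m - m)) with (powerRZ (-1) m).
  2:{ replace (2 * m * m - m)%Z with (2 * (m * m - m) + m)%Z by ring.
      rewrite powerRZ_add, powerRZ_m1_even by lra. ring. }
  rewrite (Rmult_comm (powerRZ q d)), !Rmult_assoc. f_equal.
  rewrite <- !powerRZ_add by assumption. f_equal. ring.
Qed.

End Kronecker.

(** Only even powers of q occur, so that the constant in
    [psi_opp_mul_lambert] is the same for q and -q and can be eliminated. *)
Lemma kronecker_coef_opp (q : R) (d : Z) : kronecker_coef (- q) d = kronecker_coef q d.
Proof.
  apply zsum_ext. intros m.
  replace (4 * (d - m))%Z with (2 * (2 * (d - m)))%Z by ring.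
  rewrite !powerRZ_even. now replace ((- q) ^ 2) with (q ^ 2) by ring.
Qed.

Lemma lambert_add (q : R) : 0 < Rabs q < 1 ->
  lambert q + lambert (- q) = 2 * lambert (q ^ 2).
Proof.
  intros Hq. pose proof (abs_opp_lt_1 q Hq) as Hq'.
  unfold lambert at 1 2.
  rewrite (zsum_parity _ (lambert_summable q Hq)), (zsum_parity _ (lambert_summable (- q) Hq')).
  cbv beta.
  rewrite (zsum_ext (fun n => powerRZ (- q) (2 * n) / _)
    (fun n => powerRZ q (2 * n) / (1 + powerRZ q (4 * (2 * n))))).
  2:{ intros n. rewrite !powerRZ_opp_base.
    replace (4 * (2 * n))%Z with (2 * (4 * n))%Z by ring. rewrite !powerRZ_m1_even.
    now rewrite !Rmult_1_l. }
  rewrite (zsum_ext (fun n => powerRZ (- q) (2 * n + 1) / _)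
    (fun n => -1 * (powerRZ q (2 * n + 1) / (1 + powerRZ q (4 * (2 * n + 1)))))).
  2:{ intros n. rewrite !powerRZ_opp_base, powerRZ_m1_odd.
    replace (4 * (2 * n + 1))%Z with (2 * (2 * (2 * n + 1)))%Z by ring.
    rewrite !powerRZ_m1_even, Rmult_1_l. unfold Rdiv. ring. }
  rewrite zsum_scal. unfold lambert.
  rewrite (zsum_ext (fun j => powerRZ (q ^ 2) j / _)
    (fun n => powerRZ q (2 * n) / (1 + powerRZ q (4 * (2 * n))))); [ring |].
  intros n. rewrite <- !powerRZ_even. do 3 f_equal. ring.
Qed.

(** * Evaluation of the Lambert series *)

Lemma abs_unit (q : R) : 0 < q < 1 -> 0 < Rabs q < 1.
Proof. intros H. rewrite Rabs_pos_eq; lra. Qed.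

Lemma sqr_unit (q : R) : 0 < q < 1 -> 0 < q ^ 2 < 1.
Proof. intros H. nra. Qed.

(** W is constant along q, q^2, q^4, q^8 and so on, which tends to 0. *)
Lemma squaring_invariant (W : R -> R) (l : R) :
  (forall q, 0 < q < 1 -> W (q ^ 2) = W q) ->
  (forall x : nat -> R, (forall n, 0 < x n < 1) -> is_lim_seq x 0 ->
     is_lim_seq (fun n => W (x n)) l) ->
  forall q, 0 < q < 1 -> W q = l.
Proof.
  intros Hinv Hlim q Hq.
  assert (Hx : forall n, 0 < q ^ (2 ^ n) < 1).
  { intros n. split; [apply pow_lt; lra |].
    apply pow_lt_1_compat; [lra |]. pose proof (Nat.pow_nonzero 2 n). lia. }
  assert (HW : forall n, W (q ^ (2 ^ n)) = W q).
  { induction n as [| n IH]; [simpl; now rewrite Rmult_1_r |].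
    rewrite <- IH, <- (Hinv (q ^ 2 ^ n) (Hx n)). f_equal.
    rewrite <- pow_mult. f_equal. simpl. lia. }
  assert (Hx0 : is_lim_seq (fun n => q ^ (2 ^ n)) 0).
  { apply (is_lim_seq_subseq (fun n => q ^ n) _ (fun n => (2 ^ n)%nat)).
    - intros P [N HN]. exists N. intros n Hn. apply HN.
      pose proof (Nat.pow_gt_lin_r 2 n). lia.
    - apply is_lim_seq_geom. rewrite Rabs_pos_eq; lra. }
  specialize (Hlim _ Hx Hx0).
  apply (is_lim_seq_ext _ (fun _ => W q) _ HW) in Hlim.
  pose proof (is_lim_seq_unique _ _ Hlim) as E.
  rewrite Lim_seq_const in E. now injection E.
Qed.

Lemma lim_of_linear_error (f : R -> R) (C l : R) :
  (forall q, 0 < q < 1 -> Rabs (f q - l) <= C * q / (1 - q)) ->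
  forall x : nat -> R, (forall n, 0 < x n < 1) -> is_lim_seq x 0 ->
  is_lim_seq (fun n => f (x n)) l.
Proof.
  intros Hf x Hx Hx0.
  apply is_lim_seq_ext with (fun n => l + (f (x n) - l)); [intros; ring |].
  replace (Finite l) with (Finite (l + 0)) by (f_equal; ring).
  apply is_lim_seq_plus'; [apply is_lim_seq_const | apply is_lim_seq_abs_0].
  apply (is_lim_seq_le_le (fun _ => 0) _ (fun n => C * x n / (1 - x n)) 0).
  - intros n. split; [apply Rabs_pos | apply Hf, Hx].
  - apply is_lim_seq_const.
  - replace (Finite 0) with (Finite (C * 0 / (1 - 0))) by (f_equal; field).
    apply is_lim_seq_div'; [| | lra].
    + apply is_lim_seq_mult'; [apply is_lim_seq_const | exact Hx0].
    + apply is_lim_seq_minus'; [apply is_lim_seq_const | exact Hx0].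
Qed.

Lemma phi_near_1 (q : R) : 0 < q < 1 -> Rabs (phi q - 1) <= 2 * q / (1 - q).
Proof.
  intros H. pose proof (phi_near_0 q (abs_unit q H)) as E.
  rewrite (Rabs_pos_eq q) in E by lra. exact E.
Qed.

Lemma phi_opp_near_1 (q : R) : 0 < q < 1 -> Rabs (phi (- q) - 1) <= 2 * q / (1 - q).
Proof.
  intros H. pose proof (phi_near_0 (- q) (abs_opp_lt_1 q (abs_unit q H))) as E.
  rewrite Rabs_Ropp, (Rabs_pos_eq q) in E by lra. exact E.
Qed.

Lemma phi_ge_1 (q : R) : 0 < q < 1 -> 1 <= phi q.
Proof.
  intros H.
  exact (zsum_ge_term _ (phi_summable q (abs_unit q H)) (fun n => powerRZ_le q _ (proj1 H)) 0%Z).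
Qed.

Lemma psi_pos (q : R) : 0 < q < 1 -> 0 < psi q.
Proof.
  intros H. pose proof (zsum_ge_term _ (psi_summable q (abs_unit q H))
    (fun n => powerRZ_le q _ (proj1 H)) 0%Z) as E. cbv beta in E.
  change (1 <= psi q) in E. lra.
Qed.

(** By phi(q) phi(-q) = phi(-q^2)^2, phi(-q) is nonnegative, and a zero at q
    propagates to q^2, q^4, q^8 and so on, where phi(-q) tends to 1. *)
Lemma phi_opp_pos (q : R) : 0 < q < 1 -> 0 < phi (- q).
Proof.
  intros H.
  assert (Hge : forall r, 0 < r < 1 -> 0 <= phi (- r)).
  { intros r Hr. pose proof (phi_mul_opp r (abs_unit r Hr)) as E.
    pose proof (phi_ge_1 r Hr). pose proof (pow2_ge_0 (phi (- r ^ 2))). nra. }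
  destruct (Hge q H) as [Hlt | Hz]; [exact Hlt | exfalso].
  (* the indicator of phi (- r) <> 0 is invariant under squaring *)
  pose (W := fun r : R => if Req_EM_T (phi (- r)) 0 then 0 else 1).
  assert (HW : W q = 1).
  { apply squaring_invariant; [| | exact H].
    - intros r Hr. unfold W.
      pose proof (phi_mul_opp r (abs_unit r Hr)) as E. pose proof (phi_ge_1 r Hr).
      destruct (Req_EM_T (phi (- r ^ 2)) 0) as [E1 | E1],
        (Req_EM_T (phi (- r)) 0) as [E2 | E2]; try reflexivity; exfalso; nra.
    - intros x Hx Hx0.
      pose proof (lim_of_linear_error (fun r => phi (- r)) 2 1 phi_opp_near_1 x Hx Hx0) as Hl.
      apply is_lim_seq_ext_loc with (2 := is_lim_seq_const 1).
      destruct (proj2 (is_lim_seq_spec _ _) Hl (mkposreal 1 Rlt_0_1)) as [N HN].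
      exists N. intros n Hn. specialize (HN n Hn). simpl in HN. unfold W.
      destruct (Req_EM_T (phi (- x n)) 0) as [E | E]; [| reflexivity].
      rewrite E in HN. replace (0 - 1) with (- (1)) in HN by ring.
      rewrite Rabs_Ropp, Rabs_R1 in HN. lra. }
  unfold W in HW. destruct (Req_EM_T (phi (- q)) 0); [lra | congruence].
Qed.

(** The difference is twice the sum of q^(n^2) over odd n, which contains q at
    n = 1 and at n = -1. *)
Lemma phi_gap_lower (q : R) : 0 < q < 1 -> 4 * q <= phi q - phi (- q).
Proof.
  intros H. pose proof (phi_summable q (abs_unit q H)) as Hs.
  pose proof (phi_add q (abs_unit q H)) as E.
  assert (E4 : phi (q ^ 4) = zsum (fun n => powerRZ q (2 * n * (2 * n)))).
  { apply zsum_ext. intros n. replace (q ^ 4) with ((q ^ 2) ^ 2) by ring.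
    rewrite <- !powerRZ_even. f_equal. ring. }
  pose proof (zsum_parity _ Hs) as Ep. cbv beta in Ep. fold (phi q) in Ep. rewrite <- E4 in Ep.
  destruct (zsummable_parity _ Hs) as [_ Ho]. cbv beta in *.
  assert (Hterm : q + q <= zsum (fun n => powerRZ q ((2 * n + 1) * (2 * n + 1)))).
  { pose proof (term_le_Series (bilateral (fun n => powerRZ q ((2 * n + 1) * (2 * n + 1)))) 0)
      as Ht.
    match type of Ht with _ -> _ -> ?b <= _ =>
      change b with (powerRZ q 1 + powerRZ q 1) in Ht end.
    rewrite powerRZ_1 in Ht. apply Ht; [| apply zsummable_ex, Ho].
    intros n. apply Rplus_le_le_0_compat; apply powerRZ_le; lra. }
  lra.
Qed.

Lemma phi_gap_upper (q : R) : 0 < q < 1 -> phi q - phi (- q) <= 4 * q / (1 - q).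
Proof.
  intros H. pose proof (phi_near_1 q H) as H1. pose proof (phi_opp_near_1 q H) as H2.
  apply Rabs_le_between in H1, H2.
  replace (4 * q / (1 - q)) with (2 * q / (1 - q) + 2 * q / (1 - q)) by (field; lra). lra.
Qed.

(** Kronecker's formula at q and at -q compares lambert q to lambert (-q)
    through psi(q)^2 / psi(-q)^2 = phi(q) / phi(-q). *)
Lemma lambert_phi_opp (q : R) : 0 < q < 1 ->
  lambert q * phi (- q) = lambert (- q) * phi q.
Proof.
  intros H. pose proof (abs_unit q H) as Ha. pose proof (abs_opp_lt_1 q Ha) as Ha'.
  pose proof (psi_opp_mul_lambert q Ha) as E1.
  pose proof (psi_opp_mul_lambert (- q) Ha') as E2.
  rewrite Ropp_involutive, kronecker_coef_opp in E2.
  pose proof (psi_sqr q Ha) as S1. pose proof (psi_sqr (- q) Ha') as S2.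
  replace ((- q) ^ 2) with (q ^ 2) in S2 by ring.
  pose proof (psi_pos (q ^ 2) (sqr_unit q H)) as Hp.
  apply Rmult_eq_reg_r with (psi (q ^ 2)); [| lra].
  replace (lambert q * phi (- q) * psi (q ^ 2)) with (psi (- q) * (psi (- q) * lambert q))
    by (rewrite <- Rmult_assoc; replace (psi (- q) * psi (- q)) with (psi (- q) ^ 2) by ring;
        rewrite S2; ring).
  replace (lambert (- q) * phi q * psi (q ^ 2)) with (psi q * (psi q * lambert (- q)))
    by (rewrite <- Rmult_assoc; replace (psi q * psi q) with (psi q ^ 2) by ring;
        rewrite S1; ring).
  rewrite E1, E2. ring.
Qed.

(** As lambert / phi takes one value at q and -q, it is also the quotient of
    the sums lambert q + lambert (-q) and phi q + phi (-q). *)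
Lemma lambert_phi_descent (q : R) : 0 < q < 1 ->
  lambert (q ^ 2) * phi q = lambert q * phi (q ^ 4).
Proof.
  intros H. pose proof (lambert_phi_opp q H) as E1.
  pose proof (lambert_add q (abs_unit q H)) as E2.
  pose proof (phi_add q (abs_unit q H)) as E3. nra.
Qed.

Lemma lambert_eq (q : R) : 0 < q < 1 -> lambert q = phi q * phi (q ^ 2).
Proof.
  intros H.
  pose proof (phi_ge_1 q H). pose proof (phi_ge_1 (q ^ 2) (sqr_unit q H)).
  assert (E : lambert q / (phi q * phi (q ^ 2)) = 1).
  { apply (squaring_invariant (fun q => lambert q / (phi q * phi (q ^ 2)))); [| | exact H].
    - intros r Hr. pose proof (lambert_phi_descent r Hr) as E.
      pose proof (phi_ge_1 r Hr). pose proof (phi_ge_1 (r ^ 2) (sqr_unit r Hr)).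
      pose proof (phi_ge_1 _ (sqr_unit _ (sqr_unit r Hr))).
      replace ((r ^ 2) ^ 2) with (r ^ 4) in * by ring.
      apply Rmult_eq_reg_r with (phi r * phi (r ^ 4)); [| nra].
      transitivity (lambert (r ^ 2) * phi r / phi (r ^ 2)); [field; lra |].
      rewrite E. field. lra.
    - intros x Hx Hx0.
      replace (Finite 1) with (Finite (1 / (1 * 1))) by (f_equal; field).
      apply is_lim_seq_div'; [| apply is_lim_seq_mult' | lra].
      + apply lim_of_linear_error with (C := 4); [| exact Hx | exact Hx0].
        intros r Hr. pose proof (lambert_near_0 r (abs_unit r Hr)) as B.
        rewrite (Rabs_pos_eq r) in B by lra. exact B.
      + apply lim_of_linear_error with (C := 2); [exact phi_near_1 | exact Hx | exact Hx0].
      + apply (lim_of_linear_error phi 2 1 phi_near_1 (fun n => x n ^ 2)).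
        * intros n. apply sqr_unit, Hx.
        * apply is_lim_seq_ext with (fun n => x n * x n); [intros; ring |].
          replace (Finite 0) with (Finite (0 * 0)) by (f_equal; ring).
          now apply is_lim_seq_mult'. }
  apply (f_equal (fun t => t * (phi q * phi (q ^ 2)))) in E.
  rewrite Rmult_1_l in E. rewrite <- E. field. lra.
Qed.

Lemma lambert_opp_eq (q : R) : 0 < q < 1 -> lambert (- q) = phi (- q) * phi (q ^ 2).
Proof.
  intros H. pose proof (lambert_phi_opp q H) as E. rewrite (lambert_eq q H) in E.
  pose proof (phi_ge_1 q H).
  apply Rmult_eq_reg_r with (phi q); [| lra]. rewrite <- E. ring.
Qed.

(** The signs +, +, -, - repeat, so consecutive pairs form a geometric series of
    ratio -x^4. *)
Lemma alternating_pairs_sum (x : R) : 0 <= x < 1 ->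
  Series (fun n => (-1) ^ (n / 2) * x ^ (2 * n + 1)) = (x + x ^ 3) / (1 + x ^ 4).
Proof.
  intros Hx.
  assert (Hex : ex_series (fun n => (-1) ^ (n / 2) * x ^ (2 * n + 1))).
  { apply (ex_series_le_R _ (fun n => x * (x ^ 2) ^ n)).
    - intros n. rewrite Rabs_mult, pow_1_abs, Rmult_1_l.
      rewrite Rabs_pos_eq by (apply pow_le; lra). right.
      rewrite pow_add, pow_mult. ring.
    - apply ex_series_scal_R, ex_series_geom. rewrite Rabs_pos_eq; nra. }
  rewrite <- (is_series_unique _ _ (Series_pairs _ Hex)).
  rewrite (Series_ext _ (fun m => (x + x ^ 3) * (- x ^ 4) ^ m)).
  - assert (0 <= x ^ 4 < 1).
    { replace (x ^ 4) with ((x ^ 2) ^ 2) by ring. assert (0 <= x ^ 2 < 1) by nra. nra. }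
    rewrite Series_scal_l, Series_geom.
    + unfold Rdiv. f_equal. f_equal. ring.
    + rewrite Rabs_Ropp, Rabs_pos_eq; lra.
  - intros m.
    replace (2 * m / 2)%nat with m by (rewrite Nat.mul_comm, Nat.div_mul; lia).
    replace ((2 * m + 1) / 2)%nat with m.
    2:{ rewrite Nat.add_comm, Nat.mul_comm, Nat.div_add by lia. reflexivity. }
    replace (- x ^ 4) with (-1 * x ^ 4) by ring.
    rewrite Rpow_mult_distr, <- pow_mult.
    replace (2 * (2 * m) + 1)%nat with (4 * m + 1)%nat by lia.
    replace (2 * (2 * m + 1) + 1)%nat with (4 * m + 3)%nat by lia.
    rewrite !pow_add. ring_R.
Qed.

Lemma inv_one_plus_series (y : R) : 0 <= y < 1 ->
  Series (fun j => (-1) ^ j * y ^ (S j)) = y / (1 + y).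
Proof.
  intros Hy.
  rewrite (Series_ext _ (fun j => y * (- y) ^ j)).
  - rewrite Series_scal_l, Series_geom by (rewrite Rabs_Ropp, Rabs_pos_eq; lra).
    unfold Rdiv. do 2 f_equal. ring.
  - intros j. replace (- y) with (-1 * y) by ring. rewrite Rpow_mult_distr. simpl. ring_R.
Qed.

(** Expand each term in powers of q^(2n+1) and sum over n first: with
    x = q^(j+1) the inner sums are (x + x^3) / (1 + x^4), up to sign
    the terms of lambert (-q). *)
Lemma odd_lambert_series (q : R) : 0 < q < 1 ->
  Series (fun n => (-1) ^ (n / 2) * (q ^ (2 * n + 1) / (1 + q ^ (2 * n + 1))))
  = 1 / 2 - phi (- q) * phi (q ^ 2) / 2.
Proof.
  intros H.
  assert (Hpw : forall n, 0 < q ^ S n <= q).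
  { intros n. split; [apply pow_lt; lra |]. simpl.
    assert (q ^ n <= 1) by (rewrite <- (pow1 n); apply pow_incr; lra).
    pose proof (pow_lt q n). nra. }
  assert (Hodd : forall n, 0 <= q ^ (2 * n + 1) < 1).
  { intros n. rewrite Nat.add_1_r. pose proof (Hpw (2 * n)%nat). lra. }
  pose (a := fun n j : nat => (-1) ^ (n / 2) * ((-1) ^ j * (q ^ (2 * n + 1)) ^ S j)).
  assert (Habs : forall n j, Rabs (a n j) = (q ^ (2 * n + 1)) ^ S j).
  { intros n j. unfold a. rewrite !Rabs_mult, !pow_1_abs, !Rmult_1_l.
    apply Rabs_pos_eq, pow_le, Hodd. }
  assert (Hle : forall n j, Rabs (a n j) <= q * (q ^ 2) ^ n * q ^ j).
  { intros n j. rewrite Habs, <- tech_pow_Rmult.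
    apply Rmult_le_compat; [apply Hodd | apply pow_le, Hodd | |].
    - right. rewrite pow_add, pow_mult. ring.
    - apply pow_incr. rewrite Nat.add_1_r. pose proof (Hpw (2 * n)%nat). lra. }
  assert (Hg1 : forall c, ex_series (fun j => c * q ^ j)).
  { intros c. apply ex_series_scal_R, ex_series_geom. rewrite Rabs_pos_eq; lra. }
  assert (Hrow : forall n, ex_series (fun j => Rabs (a n j))).
  { intros n. apply (ex_series_le_R _ (fun j => q * (q ^ 2) ^ n * q ^ j)); [| apply Hg1].
    intros j. rewrite Rabs_Rabsolu. apply Hle. }
  assert (Hf : is_series (fun j => Series (fun n => a n j)) (Series (fun n => Series (a n)))).
  { apply Series_fubini; [exact Hrow |].
    apply (ex_series_le_R _ (fun n => q / (1 - q) * (q ^ 2) ^ n)).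
    - intros n. rewrite Rabs_pos_eq by (apply Series_ge_0; [intros; apply Rabs_pos | apply Hrow]).
      replace (q / (1 - q) * (q ^ 2) ^ n) with (Series (fun j => q * (q ^ 2) ^ n * q ^ j)).
      + apply Series_le; [| apply Hg1]. intros j. split; [apply Rabs_pos | apply Hle].
      + rewrite Series_scal_l, Series_geom by (rewrite Rabs_pos_eq; lra). field. lra.
    - apply ex_series_scal_R, ex_series_geom. rewrite Rabs_pos_eq; nra. }
  rewrite (Series_ext _ (fun n => Series (a n))).
  2:{ intros n. unfold a. rewrite Series_scal_l, inv_one_plus_series by apply Hodd.
      reflexivity. }
  rewrite <- (is_series_unique _ _ Hf).
  pose (h := fun j => (-1) ^ j * ((q ^ S j + (q ^ S j) ^ 3) / (1 + (q ^ S j) ^ 4))).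
  rewrite (Series_ext _ h).
  2:{ intros j. unfold h. rewrite <- alternating_pairs_sum by (pose proof (Hpw j); lra).
    rewrite <- Series_scal_l. apply Series_ext. intros n. unfold a.
    rewrite <- !pow_mult. rewrite (Nat.mul_comm (S j)). ring_R. }
  rewrite <- lambert_opp_eq by exact H.
  unfold lambert.
  destruct (zsum_center _ (lambert_summable (- q) (abs_opp_lt_1 q (abs_unit q H)))) as [_ ->].
  rewrite Z.mul_0_r, !powerRZ_O.
  rewrite (Series_ext (fun n => _ + _) (fun j => -1 * h j)).
  { rewrite Series_scal_l. field. }
  intros j. unfold h.
  replace (4 * - Z.of_nat (S j))%Z with (- (4 * Z.of_nat (S j)))%Z by ring.
  rewrite !powerRZ_neg'.
  replace (powerRZ (- q) (4 * Z.of_nat (S j))) with ((q ^ S j) ^ 4).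
  2:{ replace (4 * Z.of_nat (S j))%Z with (2 * Z.of_nat (2 * S j))%Z by lia.
      rewrite powerRZ_even, <- pow_powerRZ.
      replace ((- q) ^ 2) with (q ^ 2) by ring. rewrite <- !pow_mult. f_equal. lia. }
  rewrite <- pow_powerRZ. replace (- q) with (-1 * q) by ring.
  rewrite Rpow_mult_distr.
  assert (Hx : 0 < q ^ S j) by apply Hpw. set (x := q ^ S j) in *.
  assert (0 < x ^ 4) by (apply pow_lt, Hx).
  change ((-1) ^ S j) with (-1 * (-1) ^ j).
  assert (Hs : (-1) ^ j * (-1) ^ j = 1).
  { rewrite <- Rpow_mult_distr. replace (-1 * -1) with 1 by ring. apply pow1. }
  assert (Hs' : (-1) ^ j <> 0) by (intros E; rewrite E in Hs; lra).
  set (s := (-1) ^ j) in *.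
  assert (Hi : / (-1 * s * x) = -1 * s * / x).
  { apply Rmult_eq_reg_l with (-1 * s * x).
    - rewrite Rinv_r; [| nra]. transitivity (s * s * (x * / x)); [| ring].
      rewrite Hs, Rinv_r; lra.
    - nra. }
  rewrite Hi. change (@eq R (-1 * s * x / (1 + x ^ 4) + -1 * s * / x / (1 + / x ^ 4))
    (-1 * (s * ((x + x ^ 3) / (1 + x ^ 4))))).
  field. split; [nra | lra].
Qed.

(** * Landen's transformation and the logarithmic singularity of K *)

Lemma ellK_sqr_ext (k l : R) : k ^ 2 = l ^ 2 -> ellK k = ellK l.
Proof. intros H. unfold ellK. now rewrite H. Qed.

Lemma compl_modulus_sqr (k : R) : k ^ 2 <= 1 -> compl_modulus k ^ 2 = 1 - k ^ 2.
Proof. intros H. unfold compl_modulus. rewrite pow2_sqrt; lra. Qed.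

Lemma compl_modulus_bounds (k : R) : 0 < k ^ 2 < 1 -> 0 < compl_modulus k < 1.
Proof.
  intros H. unfold compl_modulus. split.
  - apply sqrt_lt_R0. lra.
  - rewrite <- sqrt_1 at 2. apply sqrt_lt_1; lra.
Qed.

Lemma sin_sqr_bounds (x : R) : 0 <= sin x ^ 2 <= 1.
Proof. pose proof (SIN_bound x). nra. Qed.

Lemma Delta_pos (k x : R) : k ^ 2 < 1 -> 0 < 1 - k ^ 2 * sin x ^ 2.
Proof. intros H. pose proof (sin_sqr_bounds x). pose proof (pow2_ge_0 k). nra. Qed.

Lemma ellK_integrand_continuous (k x : R) : k ^ 2 < 1 ->
  continuous (fun t => / sqrt (1 - k ^ 2 * sin t ^ 2)) x.
Proof.
  intros H. pose proof (Delta_pos k x H) as HD.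
  apply (ex_derive_continuous (fun t => / sqrt (1 - k ^ 2 * sin t ^ 2))).
  auto_derive. simpl in HD |- *. split; [lra |].
  split; [| exact I]. apply Rgt_not_eq, sqrt_lt_R0. lra.
Qed.

Lemma ex_RInt_ellK (k a b : R) : k ^ 2 < 1 ->
  ex_RInt (fun t => / sqrt (1 - k ^ 2 * sin t ^ 2)) a b.
Proof.
  intros H. apply (ex_RInt_continuous (V := R_CompleteNormedModule)).
  intros; now apply ellK_integrand_continuous.
Qed.

Lemma ellK_increasing (k l : R) : 0 <= k < l -> l < 1 -> ellK k < ellK l.
Proof.
  intros Hk Hl. pose proof PI_RGT_0.
  assert (k ^ 2 < 1) by nra. assert (l ^ 2 < 1) by nra.
  apply RInt_lt; [lra | | |].
  - intros; now apply ellK_integrand_continuous.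
  - intros; now apply ellK_integrand_continuous.
  - intros x Hx.
    assert (0 < sin x) by (apply sin_gt_0; lra).
    pose proof (Delta_pos k x ltac:(assumption)). pose proof (Delta_pos l x ltac:(assumption)).
    apply Rinv_lt_contravar.
    + apply Rmult_lt_0_compat; apply sqrt_lt_R0; assumption.
    + apply sqrt_lt_1; [lra | lra |].
      assert (k ^ 2 < l ^ 2) by nra. assert (0 < sin x ^ 2) by nra. nra.
Qed.

Lemma ellK_bounds (k : R) : k ^ 2 < 1 ->
  PI / 2 <= ellK k <= PI / 2 / sqrt (1 - k ^ 2).
Proof.
  intros H. pose proof PI_RGT_0.
  assert (Hc : forall c, RInt (fun _ => c) 0 (PI / 2) = PI / 2 * c).
  { intros c. rewrite RInt_const. unfold scal; simpl. unfold mult; simpl. ring. }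
  split.
  - rewrite <- (Rmult_1_r (PI / 2)), <- Hc.
    apply RInt_le; [lra | apply ex_RInt_const | now apply ex_RInt_ellK |].
    intros x _. pose proof (Delta_pos k x H). pose proof (sin_sqr_bounds x).
    pose proof (pow2_ge_0 k). rewrite <- Rinv_1 at 1. apply Rinv_le_contravar.
    + now apply sqrt_lt_R0.
    + rewrite <- sqrt_1 at 2. apply sqrt_le_1_alt. nra.
  - change (ellK k <= PI / 2 * / sqrt (1 - k ^ 2)). rewrite <- Hc.
    apply RInt_le; [lra | now apply ex_RInt_ellK | apply ex_RInt_const |].
    intros x _. pose proof (sin_sqr_bounds x). pose proof (pow2_ge_0 k).
    apply Rinv_le_contravar; [apply sqrt_lt_R0; lra |].
    apply sqrt_le_1_alt. nra.
Qed.

Lemma ellK_pos (k : R) : k ^ 2 < 1 -> 0 < ellK k.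
Proof. intros H. pose proof (ellK_bounds k H). pose proof PI_RGT_0. lra. Qed.

Lemma is_derive_asin (x : R) : -1 < x < 1 -> is_derive asin x (/ sqrt (1 - x ^ 2)).
Proof.
  intros Hx. apply is_derive_Reals.
  pose proof (derive_pt_asin x Hx) as E. apply derive_pt_eq_1 in E.
  replace (/ sqrt (1 - x ^ 2)) with (1 / sqrt (1 - x²)); [exact E |].
  unfold Rdiv, Rsqr. rewrite Rmult_1_l. do 3 f_equal. ring.
Qed.

Lemma RInt_ellK_symmetric (k : R) : k ^ 2 < 1 ->
  RInt (fun t => / sqrt (1 - k ^ 2 * sin t ^ 2)) 0 PI = 2 * ellK k.
Proof.
  intros H. set (f := fun t => / sqrt (1 - k ^ 2 * sin t ^ 2)).
  rewrite <- (RInt_Chasles f 0 (PI / 2) PI) by now apply ex_RInt_ellK.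
  assert (E : RInt f (PI / 2) PI = ellK k).
  { pose proof (RInt_comp (V := R_CompleteNormedModule) f (fun t => PI - t) (fun _ => -1)
      (PI / 2) 0) as C. cbv beta in C.
    replace (PI - PI / 2) with (PI / 2) in C by field. rewrite Rminus_0_r in C.
    rewrite <- C.
    - rewrite (RInt_ext _ (fun t => scal (-1) (f t))).
      + rewrite (RInt_scal (V := R_CompleteNormedModule) f), <- opp_RInt_swap
          by now apply ex_RInt_ellK.
        change (-1 * - ellK k = ellK k). ring.
      + intros t _. unfold f. now rewrite sin_PI_x.
    - intros; now apply ellK_integrand_continuous.
    - intros t _. split; [auto_derive; [easy | ring] | apply continuous_const]. }
  rewrite E. change (ellK k + ellK k = 2 * ellK k). ring.
Qed.

(** The substitution t = (x + asin (k sin x)) / 2 maps [0, PI] onto [0, PI/2].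
    Its derivative is (De + k cos x) / (2 De), with De = sqrt (1 - k^2 sin^2 x),
    and 1 - l^2 sin^2 t is the square of (De + k cos x) / (1 + k), so the factor
    De + k cos x cancels. *)
Lemma landen (k : R) : 0 <= k < 1 ->
  ellK (2 * sqrt k / (1 + k)) = (1 + k) * ellK k.
Proof.
  intros Hk. assert (Hk2 : k ^ 2 < 1) by nra.
  set (l := 2 * sqrt k / (1 + k)).
  assert (Hl : l ^ 2 = 4 * k / (1 + k) ^ 2).
  { unfold l. replace ((2 * sqrt k / (1 + k)) ^ 2) with (4 * sqrt k ^ 2 / (1 + k) ^ 2)
      by (field; lra). now rewrite pow2_sqrt. }
  assert (Hl1 : 1 - l ^ 2 = ((1 - k) / (1 + k)) ^ 2) by (rewrite Hl; field; lra).
  assert (Hl2 : l ^ 2 < 1).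
  { assert (0 < (1 - k) / (1 + k)) by (apply Rdiv_lt_0_compat; lra).
    pose proof (pow_lt _ 2 H). lra. }
  set (f := fun t => / sqrt (1 - l ^ 2 * sin t ^ 2)).
  set (De := fun x => sqrt (1 - k ^ 2 * sin x ^ 2)).
  assert (HDe : forall x, 0 < De x) by (intros x; apply sqrt_lt_R0, Delta_pos, Hk2).
  assert (HDe2 : forall x, De x ^ 2 = 1 - k ^ 2 * sin x ^ 2)
    by (intros x; apply pow2_sqrt; pose proof (Delta_pos k x Hk2); lra).
  set (g := fun x => (x + asin (k * sin x)) / 2).
  set (dg := fun x => (1 + k * cos x / De x) / 2).
  assert (Hs : forall x, -1 < k * sin x < 1) by (intros x; pose proof (SIN_bound x); nra).
  assert (Hpos : forall x, 0 < De x + k * cos x).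
  { intros x. pose proof (sin2_cos2 x) as E. rewrite !Rsqr_pow2 in E.
    pose proof (HDe2 x). pose proof (HDe x).
    assert ((k * cos x) ^ 2 < De x ^ 2) by nra. nra. }
  assert (Hfg : forall x, f (g x) = (1 + k) / (De x + k * cos x)).
  { intros x. unfold f.
    assert (E : 1 - l ^ 2 * sin (g x) ^ 2 = ((De x + k * cos x) / (1 + k)) ^ 2).
    { replace (sin (g x) ^ 2) with ((1 - cos (2 * g x)) / 2)
        by (rewrite cos_2a_sin; field).
      replace (2 * g x) with (x + asin (k * sin x)) by (unfold g; field).
      rewrite cos_plus, sin_asin, cos_asin by (specialize (Hs x); lra).
      replace (sqrt (1 - (k * sin x)²)) with (De x)
        by (unfold De, Rsqr; f_equal; ring).
      rewrite Hl.
      pose proof (sin2_cos2 x) as E. rewrite !Rsqr_pow2 in E.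
      replace (((De x + k * cos x) / (1 + k)) ^ 2) with
        ((De x ^ 2 + 2 * De x * k * cos x + k ^ 2 * cos x ^ 2) / (1 + k) ^ 2) by (field; lra).
      rewrite HDe2. replace (cos x ^ 2) with (1 - sin x ^ 2) by lra.
      field. lra. }
    rewrite E, <- Rsqr_pow2, sqrt_Rsqr.
    - specialize (Hpos x). field. lra.
    - left. apply Rdiv_lt_0_compat; [apply Hpos | lra]. }
  assert (Hdg : forall x, is_derive g x (dg x)).
  { intros x. unfold g, dg.
    assert (Ha : is_derive (fun t => asin (k * sin t)) x (k * cos x / De x)).
    { replace (k * cos x / De x) with (scal (k * cos x) (/ sqrt (1 - (k * sin x) ^ 2))).
      - apply (is_derive_comp asin (fun t => k * sin t)); [now apply is_derive_asin |].
        auto_derive; [easy | ring].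
      - unfold De. unfold scal; simpl; unfold mult; simpl. unfold Rdiv. do 3 f_equal. ring. }
    pose proof (is_derive_plus (fun t => t) (fun t => asin (k * sin t)) x 1 _
      (is_derive_id x) Ha) as Hp.
    pose proof (is_derive_scal _ x (/ 2) _ Hp) as Hsc.
    replace ((1 + k * cos x / De x) / 2) with (/ 2 * plus 1 (k * cos x / De x)).
    - apply is_derive_ext with (2 := Hsc). intros t. unfold plus; simpl. field.
    - unfold plus; simpl. specialize (HDe x). field. lra. }
  assert (C : RInt (fun y => scal (dg y) (f (g y))) 0 PI = RInt f (g 0) (g PI)).
  { apply (RInt_comp (V := R_CompleteNormedModule)).
    - intros; now apply ellK_integrand_continuous.
    - intros x _. split; [apply Hdg |].
      apply (ex_derive_continuous dg). unfold dg, De.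
      pose proof (Delta_pos k x Hk2) as HD. auto_derive. simpl in HD |- *.
      split; [lra |]. split; [| exact I]. apply Rgt_not_eq, sqrt_lt_R0. lra. }
  replace (g 0) with 0 in C by (unfold g; rewrite sin_0, Rmult_0_r, asin_0; field).
  replace (g PI) with (PI / 2) in C by (unfold g; rewrite sin_PI, Rmult_0_r, asin_0; field).
  change (RInt f 0 (PI / 2)) with (ellK l) in C. rewrite <- C.
  rewrite (RInt_ext _ (fun x => scal ((1 + k) / 2) (/ sqrt (1 - k ^ 2 * sin x ^ 2)))).
  - rewrite (RInt_scal (V := R_CompleteNormedModule) (fun t => / sqrt (1 - k ^ 2 * sin t ^ 2)))
      by now apply ex_RInt_ellK.
    rewrite RInt_ellK_symmetric by assumption.
    unfold scal; simpl; unfold mult; simpl. field.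
  - intros x _. rewrite Hfg. unfold scal; simpl; unfold mult; simpl. unfold dg.
    change (sqrt (1 - k * (k * 1) * (sin x * (sin x * 1)))) with (De x).
    specialize (HDe x). specialize (Hpos x). field. lra.
Qed.

(** The moduli (1 - k) / (1 + k) and 2 sqrt k / (1 + k) are complementary. *)
Lemma landen_compl (k : R) : 0 < k < 1 ->
  ellK (compl_modulus ((1 - k) / (1 + k))) = (1 + k) * ellK k.
Proof.
  intros Hk. rewrite <- landen by lra. apply ellK_sqr_ext.
  assert (0 < (1 - k) / (1 + k)) by (apply Rdiv_lt_0_compat; lra).
  assert ((1 - k) / (1 + k) < 1) by (apply (Rmult_lt_reg_r (1 + k)); [lra |];
    unfold Rdiv; rewrite Rmult_assoc, Rinv_l; lra).
  rewrite compl_modulus_sqr by nra.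
  replace ((2 * sqrt k / (1 + k)) ^ 2) with (4 * sqrt k ^ 2 / (1 + k) ^ 2) by (field; lra).
  rewrite pow2_sqrt by lra. field. lra.
Qed.

Section Asymptotics.
Variable k : R.
Hypothesis Hk : 0 < k < 1.

(** The radicand of K(k') after the reflection of [0, PI/2]. *)
Let N (x : R) : R := sin x ^ 2 + k ^ 2 * cos x ^ 2.

Lemma reflected_lower (x : R) : k ^ 2 <= N x.
Proof.
  unfold N. pose proof (sin2_cos2 x) as E. rewrite !Rsqr_pow2 in E.
  pose proof (sin_sqr_bounds x). assert (k ^ 2 < 1) by nra. nra.
Qed.

Lemma reflected_continuous (x : R) : continuous (fun t => / sqrt (N t)) x.
Proof.
  assert (HN : 0 < N x) by (pose proof (reflected_lower x); nra).
  apply (ex_derive_continuous (fun t => / sqrt (N t))). unfold N in *.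
  auto_derive. simpl in HN |- *. split; [lra |].
  split; [| exact I]. apply Rgt_not_eq, sqrt_lt_R0. lra.
Qed.

Lemma reflected_integrable (a b : R) : ex_RInt (fun t => / sqrt (N t)) a b.
Proof.
  apply (ex_RInt_continuous (V := R_CompleteNormedModule)). intros; apply reflected_continuous.
Qed.

Lemma ellK_compl_reflected :
  ellK (compl_modulus k) = RInt (fun t => / sqrt (N t)) 0 (PI / 2).
Proof.
  assert (Hc : compl_modulus k ^ 2 = 1 - k ^ 2) by (apply compl_modulus_sqr; nra).
  assert (Hc1 : compl_modulus k ^ 2 < 1) by nra.
  pose proof (RInt_comp (V := R_CompleteNormedModule)
    (fun t => / sqrt (1 - compl_modulus k ^ 2 * sin t ^ 2))
    (fun t => PI / 2 - t) (fun _ => -1) (PI / 2) 0) as C. cbv beta in C.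
  replace (PI / 2 - PI / 2) with 0 in C by ring. rewrite Rminus_0_r in C.
  unfold ellK. rewrite <- C.
  - rewrite (RInt_ext _ (fun t => scal (-1) (/ sqrt (N t)))).
    + rewrite (RInt_scal (V := R_CompleteNormedModule) (fun t => / sqrt (N t))),
        <- opp_RInt_swap by apply reflected_integrable.
      unfold scal, opp; simpl; unfold mult; simpl. ring.
    + intros t _. do 3 f_equal. rewrite sin_shift, Hc. unfold N.
      pose proof (sin2_cos2 t) as E. rewrite !Rsqr_pow2 in E. nra.
  - intros; now apply ellK_integrand_continuous.
  - intros t _. split; [auto_derive; [easy | ring] | apply continuous_const].
Qed.

(** The root sqrt (sin^2 x + k^2 cos^2 x) is at most x + k. *)
Lemma ellK_compl_lower : - ln k <= ellK (compl_modulus k).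
Proof.
  rewrite ellK_compl_reflected. pose proof PI2_1 as HPI.
  assert (HI : is_RInt (fun t => / (t + k)) 0 (PI / 2) (ln (PI / 2 + k) - ln (0 + k))).
  { apply (is_RInt_derive (fun t => ln (t + k))).
    - intros x Hx. rewrite Rmin_left, Rmax_right in Hx by lra.
      auto_derive; [lra | field; lra].
    - intros x Hx. rewrite Rmin_left, Rmax_right in Hx by lra.
      apply (ex_derive_continuous (fun t => / (t + k))). auto_derive. lra. }
  apply Rle_trans with (RInt (fun t => / (t + k)) 0 (PI / 2)).
  - rewrite (is_RInt_unique _ _ _ _ HI), Rplus_0_l.
    assert (0 <= ln (PI / 2 + k)) by (rewrite <- ln_1; apply ln_le; lra). lra.
  - apply RInt_le; [lra | eexists; exact HI | apply reflected_integrable |].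
    intros x Hx. pose proof (reflected_lower x) as HN.
    apply Rinv_le_contravar; [apply sqrt_lt_R0; nra |].
    rewrite <- (sqrt_pow2 (x + k)) by lra. apply sqrt_le_1_alt. unfold N.
    assert (0 < sin x) by (apply sin_gt_0; lra).
    pose proof (sin_lt_x x ltac:(lra)).
    pose proof (COS_bound x). assert (cos x ^ 2 <= 1) by nra. nra.
Qed.

(** The cubic Taylor bound x - x^3/6 <= sin x at x = k/2. *)
Lemma sin_half_lower : k / 4 <= sin (k / 2).
Proof.
  destruct (sin_bound (k / 2) 0) as [H _]; [lra | pose proof PI2_1; lra |].
  unfold sin_approx, sin_term in H. simpl in H. nra.
Qed.

(** The integrand is at most 1/k on [0, k] and at most 1/sin x beyond. *)
Lemma ellK_compl_upper : ellK (compl_modulus k) <= 1 + ln 4 - ln k.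
Proof.
  rewrite ellK_compl_reflected. pose proof PI2_1 as HPI.
  rewrite <- (RInt_Chasles (fun t => / sqrt (N t)) 0 k (PI / 2)) by apply reflected_integrable.
  assert (H1 : RInt (fun t => / sqrt (N t)) 0 k <= 1).
  { replace 1 with (RInt (fun _ => / k) 0 k).
    - apply RInt_le; [lra | apply reflected_integrable | apply ex_RInt_const |].
      intros x _. apply Rinv_le_contravar; [lra |].
      rewrite <- (sqrt_pow2 k) at 1 by lra. apply sqrt_le_1_alt, reflected_lower.
    - rewrite RInt_const. unfold scal; simpl; unfold mult; simpl. field. lra. }
  (* ln (tan (t / 2)), a primitive of 1 / sin t that vanishes at PI / 2 *)
  set (G := fun t => ln (sin (t / 2)) - ln (cos (t / 2))).
  assert (Hsc : forall x, k <= x <= PI / 2 -> 0 < sin (x / 2) /\ 0 < cos (x / 2)).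
  { intros x Hx. split; [apply sin_gt_0; lra | apply cos_gt_0; lra]. }
  assert (HI : is_RInt (fun t => / sin t) k (PI / 2) (G (PI / 2) - G k)).
  { apply (is_RInt_derive G).
    - intros x Hx. rewrite Rmin_left, Rmax_right in Hx by lra.
      destruct (Hsc x Hx) as [Ps Pc]. unfold G. auto_derive; [easy |].
      replace (sin x) with (2 * sin (x / 2) * cos (x / 2))
        by (rewrite <- sin_2a; f_equal; field).
      pose proof (sin2_cos2 (x / 2)) as E. rewrite !Rsqr_pow2 in E.
      unfold Rdiv in *.
      apply Rmult_eq_reg_r with (2 * sin (x * / 2) * cos (x * / 2)); [| nra].
      rewrite (Rinv_l (2 * _ * _)) by nra.
      transitivity (sin (x * / 2) ^ 2 + cos (x * / 2) ^ 2); [field; lra | exact E].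
    - intros x Hx. rewrite Rmin_left, Rmax_right in Hx by lra.
      apply (ex_derive_continuous (fun t => / sin t)). auto_derive.
      apply Rgt_not_eq, sin_gt_0; lra. }
  assert (H2 : RInt (fun t => / sqrt (N t)) k (PI / 2) <= ln 4 - ln k).
  { apply Rle_trans with (RInt (fun t => / sin t) k (PI / 2)).
    - apply RInt_le; [lra | apply reflected_integrable | eexists; exact HI |].
      intros x Hx. assert (Ps : 0 < sin x) by (apply sin_gt_0; lra).
      apply Rinv_le_contravar; [exact Ps |].
      rewrite <- (sqrt_pow2 (sin x)) at 1 by lra. apply sqrt_le_1_alt. unfold N. nra.
    - rewrite (is_RInt_unique _ _ _ _ HI). unfold G.
      replace (PI / 2 / 2) with (PI / 4) by field. rewrite sin_PI4, cos_PI4.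
      destruct (Hsc k ltac:(lra)) as [Ps Pc].
      assert (ln (cos (k / 2)) <= 0).
      { rewrite <- ln_1. apply ln_le; [exact Pc | apply COS_bound]. }
      assert (ln (k / 4) <= ln (sin (k / 2))) by (apply ln_le; [lra | apply sin_half_lower]).
      unfold Rdiv in H0 at 1. rewrite ln_mult, ln_Rinv in H0 by lra. lra. }
  unfold plus; simpl. lra.
Qed.

End Asymptotics.

(** * Theta parametrization of the elliptic integrals *)

(** The complementary modulus k' that belongs to the nome q. *)
Definition theta_modulus (q : R) : R := (phi (- q) / phi q) ^ 2.

Lemma theta_ratio_bounds (q : R) : 0 < q < 1 -> 0 < phi (- q) / phi q < 1.
Proof.
  intros H. pose proof (phi_ge_1 q H). pose proof (phi_opp_pos q H).
  pose proof (phi_gap_lower q H). split.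
  - apply Rdiv_lt_0_compat; lra.
  - apply (Rmult_lt_reg_r (phi q)); [lra |]. unfold Rdiv. rewrite Rmult_assoc, Rinv_l; lra.
Qed.

Lemma theta_modulus_bounds (q : R) : 0 < q < 1 -> 0 < theta_modulus q < 1.
Proof. intros H. apply sqr_unit, theta_ratio_bounds, H. Qed.

Lemma one_plus_theta_modulus (q : R) : 0 < q < 1 ->
  1 + theta_modulus q = 2 * phi (q ^ 2) ^ 2 / phi q ^ 2.
Proof.
  intros H. pose proof (phi_ge_1 q H).
  rewrite <- phi_sqr_add by now apply abs_unit. unfold theta_modulus. field. lra.
Qed.

(** In terms of phi(q)^2 and phi(-q)^2, passing from q to q^2 is one step of
    the arithmetic-geometric mean. *)
Lemma theta_modulus_sqr (q : R) : 0 < q < 1 ->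
  theta_modulus (q ^ 2) = 2 * sqrt (theta_modulus q) / (1 + theta_modulus q).
Proof.
  intros H. pose proof (phi_ge_1 q H). pose proof (phi_ge_1 _ (sqr_unit q H)).
  rewrite one_plus_theta_modulus by exact H. unfold theta_modulus.
  rewrite sqrt_pow2 by (pose proof (theta_ratio_bounds q H); lra).
  unfold Rdiv at 1. rewrite Rpow_mult_distr.
  rewrite <- phi_mul_opp by now apply abs_unit. field. lra.
Qed.

Lemma ellK_theta_step (q : R) : 0 < q < 1 ->
  ellK (theta_modulus (q ^ 2)) = (1 + theta_modulus q) * ellK (theta_modulus q).
Proof.
  intros H. rewrite theta_modulus_sqr by exact H. apply landen.
  pose proof (theta_modulus_bounds q H). lra.
Qed.

(** Landen's transformation applied to k1 = (1 - m) / (1 + m), m = m(q): this k1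
    is the modulus complementary to m(q^2). *)
Lemma ellK_theta_compl_step (q : R) : 0 < q < 1 ->
  (1 + theta_modulus q) * ellK (compl_modulus (theta_modulus q))
  = 2 * ellK (compl_modulus (theta_modulus (q ^ 2))).
Proof.
  intros H. pose proof (theta_modulus_bounds q H) as Hm.
  pose proof (theta_modulus_bounds _ (sqr_unit q H)) as Hm2.
  pose proof (theta_modulus_sqr q H) as E.
  set (m := theta_modulus q) in *. set (k1 := (1 - m) / (1 + m)).
  assert (Hk1 : 0 < k1 < 1).
  { unfold k1. split; [apply Rdiv_lt_0_compat; lra |].
    apply (Rmult_lt_reg_r (1 + m)); [lra |]. unfold Rdiv. rewrite Rmult_assoc, Rinv_l; lra. }
  pose proof (landen_compl k1 Hk1) as L.
  replace ((1 - k1) / (1 + k1)) with m in L by (unfold k1; field; lra).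
  rewrite L. rewrite (ellK_sqr_ext k1 (compl_modulus (theta_modulus (q ^ 2)))).
  - replace (1 + k1) with (2 / (1 + m)) by (unfold k1; field; lra). field. lra.
  - rewrite compl_modulus_sqr by nra. rewrite E.
    replace ((2 * sqrt m / (1 + m)) ^ 2) with (4 * sqrt m ^ 2 / (1 + m) ^ 2) by (field; lra).
    rewrite pow2_sqrt by lra. unfold k1. field. lra.
Qed.

Lemma lim_sqr_near_1 (f : R -> R) (C : R) (x : nat -> R) :
  (forall q, 0 < q < 1 -> Rabs (f q - 1) <= C * q / (1 - q)) ->
  (forall n, 0 < x n < 1) -> is_lim_seq x 0 ->
  is_lim_seq (fun n => f (x n) ^ 2) 1.
Proof.
  intros Hf Hx Hx0. pose proof (lim_of_linear_error f C 1 Hf x Hx Hx0) as Hl.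
  apply is_lim_seq_ext with (fun n => f (x n) * f (x n)); [intros; ring |].
  replace (Finite 1) with (Finite (1 * 1)) by (f_equal; ring).
  now apply is_lim_seq_mult'.
Qed.

Lemma theta_modulus_lim (x : nat -> R) :
  (forall n, 0 < x n < 1) -> is_lim_seq x 0 ->
  is_lim_seq (fun n => theta_modulus (x n)) 1.
Proof.
  intros Hx Hx0.
  apply is_lim_seq_ext with (fun n => phi (- x n) ^ 2 / phi (x n) ^ 2).
  { intros n. pose proof (phi_ge_1 _ (Hx n)). unfold theta_modulus. field. lra. }
  replace (Finite 1) with (Finite (1 / 1)) by (f_equal; field).
  apply is_lim_seq_div'; [| | lra].
  - exact (lim_sqr_near_1 (fun q => phi (- q)) 2 x phi_opp_near_1 Hx Hx0).
  - exact (lim_sqr_near_1 phi 2 x phi_near_1 Hx Hx0).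
Qed.

Lemma ellK_theta_compl (q : R) : 0 < q < 1 ->
  ellK (compl_modulus (theta_modulus q)) = PI / 2 * phi q ^ 2.
Proof.
  intros H. pose proof (phi_ge_1 q H).
  assert (E : ellK (compl_modulus (theta_modulus q)) / phi q ^ 2 = PI / 2).
  { apply (squaring_invariant
      (fun q => ellK (compl_modulus (theta_modulus q)) / phi q ^ 2)); [| | exact H].
    - intros r Hr. pose proof (ellK_theta_compl_step r Hr) as E.
      pose proof (phi_ge_1 r Hr). pose proof (phi_ge_1 _ (sqr_unit r Hr)).
      rewrite one_plus_theta_modulus in E by exact Hr.
      apply Rmult_eq_reg_l with 2; [| lra].
      unfold Rdiv at 1. rewrite <- Rmult_assoc, <- E. field. lra.
    - intros x Hx Hx0.
      replace (Finite (PI / 2)) with (Finite (PI / 2 / 1)) by (f_equal; field).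
      apply is_lim_seq_div'; [| exact (lim_sqr_near_1 phi 2 x phi_near_1 Hx Hx0) | lra].
      apply (is_lim_seq_le_le (fun _ => PI / 2) _ (fun n => PI / 2 / theta_modulus (x n))).
      + intros n. pose proof (theta_modulus_bounds _ (Hx n)) as Hm.
        assert (Hc : compl_modulus (theta_modulus (x n)) ^ 2 = 1 - theta_modulus (x n) ^ 2)
          by (apply compl_modulus_sqr; nra).
        pose proof (ellK_bounds (compl_modulus (theta_modulus (x n)))) as B.
        rewrite Hc in B.
        replace (1 - (1 - theta_modulus (x n) ^ 2)) with (theta_modulus (x n) ^ 2) in B by ring.
        rewrite sqrt_pow2 in B by lra. apply B. nra.
      + apply is_lim_seq_const.
      + replace (Finite (PI / 2)) with (Finite (PI / 2 / 1)) by (f_equal; field).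
        apply is_lim_seq_div'; [apply is_lim_seq_const | now apply theta_modulus_lim | lra]. }
  rewrite <- E. field. lra.
Qed.

(** The modulus k complementary to m(x) satisfies x <= k^2 <= 32 x, and
    K(k') differs from - ln k by a bounded amount. *)
Lemma ellK_theta_log_bound (x : R) : 0 < x <= 1 / 2 ->
  Rabs (ellK (theta_modulus x) + ln x / 2) <= 1 + ln 4 + ln 32.
Proof.
  intros Hx. assert (H : 0 < x < 1) by lra.
  pose proof (theta_modulus_bounds x H) as Hm.
  pose proof (theta_ratio_bounds x H) as Hr.
  pose proof (phi_ge_1 x H) as Hphi.
  set (k := compl_modulus (theta_modulus x)).
  assert (Hk2 : k ^ 2 = 1 - theta_modulus x ^ 2) by (apply compl_modulus_sqr; nra).
  assert (Hk : 0 < k < 1) by (apply compl_modulus_bounds; nra).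
  assert (Hx1 : x / (1 - x) <= 2 * x).
  { apply (Rmult_le_reg_r (1 - x)); [lra |].
    unfold Rdiv. rewrite Rmult_assoc, Rinv_l by lra. nra. }
  (* 1 - r ^ 4 is comparable to 1 - r, hence to x *)
  set (r := phi (- x) / phi x) in *.
  assert (Egap : (1 - r) * phi x = phi x - phi (- x)) by (unfold r; field; lra).
  assert (Hk_r : k ^ 2 = (1 - r) * ((1 + r) * (1 + r ^ 2)))
    by (rewrite Hk2; unfold theta_modulus; fold r; ring).
  assert (Hfac : 1 <= (1 + r) * (1 + r ^ 2) <= 4) by (split; nra).
  pose proof (phi_near_1 x H) as B1. apply Rabs_le_between in B1.
  replace (2 * x / (1 - x)) with (2 * (x / (1 - x))) in B1 by (field; lra).
  pose proof (phi_gap_lower x H) as B2. pose proof (phi_gap_upper x H) as B3.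
  replace (4 * x / (1 - x)) with (4 * (x / (1 - x))) in B3 by (field; lra).
  assert (L1 : x <= k ^ 2) by nra.
  assert (L2 : k ^ 2 <= 32 * x) by nra.
  assert (Eln : ln (k ^ 2) = 2 * ln k).
  { replace (k ^ 2) with (k * k) by ring. rewrite ln_mult by lra. ring. }
  assert (L3 : ln x <= 2 * ln k) by (rewrite <- Eln; apply ln_le; lra).
  assert (L4 : 2 * ln k <= ln 32 + ln x)
    by (rewrite <- Eln, <- ln_mult by lra; apply ln_le; nra).
  assert (Eell : ellK (theta_modulus x) = ellK (compl_modulus k)).
  { apply ellK_sqr_ext. rewrite compl_modulus_sqr by nra. rewrite Hk2. ring. }
  pose proof (ellK_compl_lower k Hk) as B4. pose proof (ellK_compl_upper k Hk) as B5.
  assert (0 < ln 4) by (rewrite <- ln_1; apply ln_increasing; lra).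
  assert (0 < ln 32) by (rewrite <- ln_1; apply ln_increasing; lra).
  rewrite Eell. apply Rabs_le. lra.
Qed.

(** Landen's transformation multiplies K(m) / phi^2 by 2 when q is squared, as
    it does ln q; the limit of the quotient follows from the logarithmic bound. *)
Lemma ellK_theta (q : R) : 0 < q < 1 ->
  ellK (theta_modulus q) = - (phi q ^ 2 * ln q / 2).
Proof.
  intros H. pose proof (phi_ge_1 q H) as Hphi.
  assert (Hln : forall r, 0 < r < 1 -> ln r < 0)
    by (intros r Hr; rewrite <- ln_1; apply ln_increasing; lra).
  assert (E : ellK (theta_modulus q) / ln q / phi q ^ 2 = - (1 / 2)).
  { apply (squaring_invariant
      (fun q => ellK (theta_modulus q) / ln q / phi q ^ 2)); [| | exact H].
    - intros r Hr. pose proof (phi_ge_1 r Hr). pose proof (phi_ge_1 _ (sqr_unit r Hr)).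
      pose proof (Hln r Hr).
      rewrite ellK_theta_step, one_plus_theta_modulus by exact Hr.
      replace (ln (r ^ 2)) with (2 * ln r).
      + field. lra.
      + replace (r ^ 2) with (r * r) by ring. rewrite ln_mult by lra. ring.
    - intros x Hx Hx0.
      replace (Finite (- (1 / 2))) with (Finite (- (1 / 2) / 1)) by (f_equal; field).
      apply is_lim_seq_div'; [| exact (lim_sqr_near_1 phi 2 x phi_near_1 Hx Hx0) | lra].
      assert (Hsmall : forall e, 0 < e -> eventually (fun n => x n < e)).
      { intros e He.
        destruct (proj2 (is_lim_seq_spec _ _) Hx0 (mkposreal e He)) as [N HN].
        exists N. intros n Hn. specialize (HN n Hn). simpl in HN.
        rewrite Rminus_0_r in HN. pose proof (Rle_abs (x n)). lra. }
      assert (Hinv : is_lim_seq (fun n => / ln (x n)) 0).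
      { apply (is_lim_seq_inv (fun n => ln (x n)) m_infty); [| easy].
        apply is_lim_seq_spec. intros M.
        destruct (Hsmall (exp M) (exp_pos M)) as [N HN]. exists N. intros n Hn.
        rewrite <- (ln_exp M). apply ln_increasing; [apply Hx | now apply HN]. }
      apply is_lim_seq_ext with
        (fun n => - (1 / 2) + (ellK (theta_modulus (x n)) / ln (x n) + 1 / 2));
        [intros; ring |].
      replace (Finite (- (1 / 2))) with (Finite (- (1 / 2) + 0)) by (f_equal; ring).
      apply is_lim_seq_plus'; [apply is_lim_seq_const | apply is_lim_seq_abs_0].
      apply (is_lim_seq_le_le_loc (fun _ => 0) _
        (fun n => (1 + ln 4 + ln 32) * Rabs (/ ln (x n))) 0).
      + destruct (Hsmall (1 / 2) ltac:(lra)) as [N HN]. exists N. intros n Hn.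
        split; [apply Rabs_pos |].
        pose proof (Hln _ (Hx n)) as Hl.
        replace (ellK (theta_modulus (x n)) / ln (x n) + 1 / 2) with
          ((ellK (theta_modulus (x n)) + ln (x n) / 2) * / ln (x n)) by (field; lra).
        rewrite Rabs_mult. apply Rmult_le_compat_r; [apply Rabs_pos |].
        apply ellK_theta_log_bound. specialize (HN n Hn). specialize (Hx n). lra.
      + apply is_lim_seq_const.
      + replace (Finite 0) with (Finite ((1 + ln 4 + ln 32) * 0)) by (f_equal; ring).
        apply is_lim_seq_mult'; [apply is_lim_seq_const |].
        rewrite <- Rabs_R0. apply is_lim_seq_abs with (l := Finite 0). exact Hinv. }
  pose proof (Hln q H).
  replace (ellK (theta_modulus q)) with
    (ellK (theta_modulus q) / ln q / phi q ^ 2 * (phi q ^ 2 * ln q)) by (field; lra).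
  rewrite E. field.
Qed.

Lemma ellK_ratio_lt (a b : R) : 0 < a < 1 -> 0 < b < 1 -> a < b ->
  ellK a * ellK (compl_modulus b) < ellK b * ellK (compl_modulus a).
Proof.
  intros Ha Hb Hab.
  assert (Hca : 0 < compl_modulus a < 1) by (apply compl_modulus_bounds; nra).
  assert (Hcb : 0 < compl_modulus b < 1) by (apply compl_modulus_bounds; nra).
  assert (Hc : compl_modulus b < compl_modulus a)
    by (unfold compl_modulus; apply sqrt_lt_1; nra).
  pose proof (ellK_increasing a b ltac:(lra) ltac:(lra)).
  pose proof (ellK_increasing (compl_modulus b) (compl_modulus a) ltac:(lra) ltac:(lra)).
  pose proof (ellK_pos a ltac:(nra)).
  pose proof (ellK_pos (compl_modulus b) ltac:(nra)).
  apply Rmult_gt_0_lt_compat; lra.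
Qed.

(** The ratio K/K' is strictly increasing in the modulus. *)
Lemma ellK_ratio_inj (a b : R) : 0 < a < 1 -> 0 < b < 1 ->
  ellK a * ellK (compl_modulus b) = ellK b * ellK (compl_modulus a) -> a = b.
Proof.
  intros Ha Hb E. destruct (Rtotal_order a b) as [Hlt | [Heq | Hgt]]; [| exact Heq |].
  - pose proof (ellK_ratio_lt a b Ha Hb Hlt). lra.
  - pose proof (ellK_ratio_lt b a Hb Ha Hgt). lra.
Qed.

(** * The nome of a modulus *)

Lemma exp_pow_nat (a : R) (n : nat) : exp a ^ n = exp (INR n * a).
Proof.
  induction n as [| n IH]; [simpl; now rewrite Rmult_0_l, exp_0 |].
  rewrite S_INR, <- tech_pow_Rmult, IH, <- exp_plus. f_equal. ring.
Qed.

Definition nome (k : R) : R := exp (- (ellK' k / ellK k * PI)).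

Lemma summand_nome (k : R) (n : nat) :
  summand k n
  = (-1) ^ (n / 2) * (nome k ^ (2 * n + 1) / (1 + nome k ^ (2 * n + 1))).
Proof.
  unfold summand, nome. rewrite exp_pow_nat, plus_INR, mult_INR.
  change (INR 2) with 2. change (INR 1) with 1.
  set (y := (2 * INR n + 1) * (ellK' k / ellK k) * PI).
  replace ((2 * INR n + 1) * - (ellK' k / ellK k * PI)) with (- y) by (unfold y; ring).
  rewrite exp_Ropp. pose proof (exp_pos y). field. lra.
Qed.

Lemma nome_bounds (k : R) : 0 < k ^ 2 < 1 -> 0 < nome k < 1.
Proof.
  intros H. pose proof (compl_modulus_bounds k H). pose proof PI_RGT_0.
  split; [apply exp_pos |]. unfold nome. rewrite <- exp_0. apply exp_increasing.
  assert (0 < ellK' k / ellK k)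
    by (apply Rdiv_lt_0_compat; apply ellK_pos; nra).
  nra.
Qed.

(** By [ellK_theta] and [ellK_theta_compl], m(q) has the ratio K/K' prescribed
    by q, which is also the ratio of the complementary modulus of k. *)
Lemma theta_modulus_nome (k : R) : 0 < k ^ 2 < 1 ->
  theta_modulus (nome k) = compl_modulus k.
Proof.
  intros H. pose proof (nome_bounds k H) as Hq. pose proof (compl_modulus_bounds k H) as Hm.
  assert (EK : ellK (compl_modulus (compl_modulus k)) = ellK k).
  { apply ellK_sqr_ext. rewrite !compl_modulus_sqr; rewrite ?compl_modulus_sqr; lra. }
  pose proof (ellK_pos k ltac:(lra)).
  apply ellK_ratio_inj; [now apply theta_modulus_bounds | exact Hm |].
  rewrite EK, ellK_theta, ellK_theta_compl by exact Hq.
  unfold nome at 2. rewrite ln_exp. unfold ellK'. field. lra.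
Qed.

Lemma ellK_nome (k : R) : 0 < k ^ 2 < 1 -> ellK k = PI / 2 * phi (nome k) ^ 2.
Proof.
  intros H. rewrite <- ellK_theta_compl, theta_modulus_nome by (exact H || now apply nome_bounds).
  apply ellK_sqr_ext. rewrite !compl_modulus_sqr; rewrite ?compl_modulus_sqr; lra.
Qed.

Lemma sqrt_sum_eq (k c : R) : k ^ 2 <= 1 -> 0 <= c -> c ^ 2 = 2 + 2 * compl_modulus k ->
  sqrt (1 - k) + sqrt (1 + k) = c.
Proof.
  intros Hk Hc E. assert (-1 <= k <= 1) by nra.
  pose proof (sqrt_pos (1 - k)). pose proof (sqrt_pos (1 + k)).
  assert (E2 : (sqrt (1 - k) + sqrt (1 + k)) ^ 2 = c ^ 2).
  { rewrite E. unfold compl_modulus. replace (1 - k ^ 2) with ((1 - k) * (1 + k)) by ring.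
    rewrite sqrt_mult by lra.
    replace (2 + 2 * (sqrt (1 - k) * sqrt (1 + k))) with
      ((1 - k) + (1 + k) + 2 * (sqrt (1 - k) * sqrt (1 + k))) by ring.
    rewrite <- (pow2_sqrt (1 - k)) at 2 by lra. rewrite <- (pow2_sqrt (1 + k)) at 2 by lra.
    ring. }
  nra.
Qed.

Theorem theorem8 (k : R) (hk : 0 < k ^ 2 < 1)
  (hconv : ex_series (summand k)) :
  Series (summand k)
  = 1 / 2
    - sqrt (compl_modulus k) * (sqrt (1 - k) + sqrt (1 + k)) * ellK k
      / (2 * PI).
Proof.
  pose proof (nome_bounds k hk) as Hq.
  pose proof (phi_ge_1 _ Hq). pose proof (phi_ge_1 _ (sqr_unit _ Hq)).
  pose proof (theta_ratio_bounds _ Hq). pose proof PI_RGT_0.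
  rewrite (Series_ext _ _ (summand_nome k)), odd_lambert_series by exact Hq.
  rewrite ellK_nome by exact hk.
  rewrite (sqrt_sum_eq k (2 * phi (nome k ^ 2) / phi (nome k))).
  - rewrite <- theta_modulus_nome by exact hk. unfold theta_modulus.
    rewrite sqrt_pow2 by lra. field. lra.
  - lra.
  - left. apply Rdiv_lt_0_compat; lra.
  - rewrite <- theta_modulus_nome by exact hk.
    replace (2 + 2 * theta_modulus (nome k)) with (2 * (1 + theta_modulus (nome k))) by ring.
    rewrite one_plus_theta_modulus by exact Hq. field. lra.
Qed.
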